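(* Let $M$ be a smooth $n$-dimensional manifold, let $\varphi=(\varphi_{ij}(x))$ be a semi-Riemannian metric on $M$, and let $(\varphi^{ij}(x))$ denote the inverse matrix of $(\varphi_{ij}(x))$. (i) If $\underset{1}{G}=\left(\underset{1}{G}{}_{(j)k}^{(1)}\right)$ are the local components of a temporal semispray on $J^{1\ast}(\mathbb{R},M)$, then the local functions $$\underset{1}{N}{}_{(r)1}^{(1)}=\varphi^{jk}\,\frac{\partial \underset{1}{G}{}_{(j)k}^{(1)}}{\partial p_i^1}\,\varphi_{ir}$$ are the components of a temporal nonlinear connection on $J^{1\ast}(\mathbb{R},M)$. Conversely, if $\underset{1}{N}=\left(\underset{1}{N}{}_{(i)1}^{(1)}\right)$ is a temporal nonlinear connection, then the local functions $$\underset{1}{G}{}_{(i)j}^{(1)}=\frac12\,\underset{1}{N}{}_{(i)1}^{(1)}\,p_j^1$$ are the local components of a temporal semispray on $J^{1\ast}(\mathbb{R},M)$. (ii) If $\underset{2}{G}=\left(\underset{2}{G}{}_{(j)i}^{(1)}\right)$ are the local components of a spatial semispray on $J^{1\ast}(\mathbb{R},M)$, then the local functions $$\underset{2}{N}{}_{(j)i}^{(1)}=2\,\underset{2}{G}{}_{(j)i}^{(1)}$$ are the components of a spatial nonlinear connection on $J^{1\ast}(\mathbb{R},M)$. Conversely, if $\underset{2}{N}=\left(\underset{2}{N}{}_{(j)i}^{(1)}\right)$ is a spatial nonlinear connection, then the local functions $$\underset{2}{G}{}_{(j)i}^{(1)}=\frac12\,\underset{2}{N}{}_{(j)i}^{(1)}$$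 are the local components of a spatial semispray on $J^{1\ast}(\mathbb{R},M)$.
   Context: Everything is smooth; the summation convention over repeated indices $i,j,k,\ldots\in\{1,\ldots,n\}$ is used. The index $1$ is a label attached to the one-dimensional time coordinate. The dual 1-jet space $J^{1\ast}(\mathbb{R},M)\equiv\mathbb{R}\times T^{\ast}M\to\mathbb{R}\times M$ is the rank-$n$ vector bundle over $\mathbb{R}\times M$ with local coordinates $(t,x^i,p_i^1)$, where $t$ is a local coordinate on $\mathbb{R}$, $(x^i)$ are local coordinates on $M$, and changes of coordinates $t\mapsto\tilde t$ on $\mathbb{R}$ and $x\mapsto\tilde x$ on $M$ induce the change of coordinates $$\tilde t=\tilde t(t),\qquad \tilde x^i=\tilde x^i(x^j),\qquad \tilde p_i^1=\frac{\partial x^j}{\partial\tilde x^i}\frac{d\tilde t}{dt}\,p_j^1,$$ with $d\tilde t/dt\neq0$ and $\det(\partial\tilde x^i/\partial x^j)\neq0$. (Equivalently, the fibre over $(t,x)$ is $T^{\ast}_xM\otimes T_t\mathbb{R}$.) Below, $\partial\tilde p_j^1/\partial t$ and $\partial\tilde p_j^1/\partial x^i$ are the partial derivatives of $\tilde p_j^1$ viewed as a function of $(t,x,p)$ through this formula. Tildes denote components in the new coordinates. A ''set of local functions'' means a family of smooth functions given on the domain of each such induced coordinate chart. Temporal semispray: a global tensor field on $J^{1\ast}(\mathbb{R},M)$ which in every induced chart has the form $$\underset{1}{G}=p_i^1\,dx^i\otimes\frac{\partial}{\partial t}-2\,\underset{1}{G}{}_{(j)i}^{(1)}\,dx^i\otimes\frac{\partial}{\partial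 p_j^1}.$$ Spatial semispray: a global tensor field on $J^{1\ast}(\mathbb{R},M)$ which in every induced chart has the form $$\underset{2}{G}=\delta_i^j\,dx^i\otimes\frac{\partial}{\partial x^j}-2\,\underset{2}{G}{}_{(j)i}^{(1)}\,dx^i\otimes\frac{\partial}{\partial p_j^1}.$$ The local functions $\underset{1}{G}{}_{(j)i}^{(1)}$, respectively $\underset{2}{G}{}_{(j)i}^{(1)}$, are called the local components of the semispray. Temporal nonlinear connection: a set of local functions $\underset{1}{N}{}_{(k)1}^{(1)}$ transforming under the coordinate changes $\tilde t=\tilde t(t)$, $\tilde x^i=\tilde x^i(x^j)$, $\tilde p_i^1=\frac{\partial x^j}{\partial\tilde x^i}\frac{d\tilde t}{dt}\,p_j^1$ by $$\underset{1}{\widetilde N}{}_{(j)1}^{(1)}=\underset{1}{N}{}_{(k)1}^{(1)}\frac{\partial x^k}{\partial\tilde x^j}-\frac{dt}{d\tilde t}\frac{\partial\tilde p_j^1}{\partial t}.$$ Spatial nonlinear connection: a set of local functions $\underset{2}{N}{}_{(k)i}^{(1)}$ transforming under the coordinate changes $\tilde t=\tilde t(t)$, $\tilde x^i=\tilde x^i(x^j)$, $\tilde p_i^1=\frac{\partial x^j}{\partial\tilde x^i}\frac{d\tilde t}{dt}\,p_j^1$ by $$\underset{2}{\widetilde N}{}_{(j)r}^{(1)}=\underset{2}{N}{}_{(k)i}^{(1)}\frac{d\tilde t}{dt}\frac{\partial x^k}{\partial\tilde x^j}\frac{\partial x^i}{\partial\tilde x^r}-\frac{\partial x^i}{\partial\tilde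 x^r}\frac{\partial\tilde p_j^1}{\partial x^i}.$$ *)

(* Defs.v *)
From HB Require Import structures.
From mathcomp Require Import all_boot all_order all_algebra.
From mathcomp Require Import all_classical all_reals all_analysis.

Set Implicit Arguments.
Unset Strict Implicit.
Unset Printing Implicit Defensive.

Import Order.TTheory GRing.Theory Num.Theory.
Import numFieldNormedType.Exports.

Local Open Scope classical_set_scope.
Local Open Scope ring_scope.

(* Points of R^m are row vectors.  The Jacobian of the library is used with its
   row convention: ('J f u) a b is the derivative of f^b with respect to u^a. *)

Section Smoothness.
Context {R : realType} {m : nat}.

Definition pderiv (f : 'rV[R]_m -> R) (a : 'I_m) (u : 'rV[R]_m) : R :=
  'D_(delta_mx 0 a) f u.

Fixpoint ndiff (k : nat) (A : set 'rV[R]_m) (f : 'rV[R]_m -> R) : Prop :=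
  (forall u, A u -> differentiable f u) /\
  (if k is k'.+1 then forall a, ndiff k' A (pderiv f a) else True).

(* C^infinity on A, which is an open set in all the uses below. *)
Definition smooth (A : set 'rV[R]_m) (f : 'rV[R]_m -> R) : Prop :=
  forall k, ndiff k A f.

Definition smooth_mx p q (A : set 'rV[R]_m) (F : 'rV[R]_m -> 'M[R]_(p, q)) :=
  forall i j, smooth A (fun u => F u i j).

End Smoothness.

Record chart (R : realType) (T : Type) (m : nat) := Chart {
  dom : set T;
  coord : T -> 'rV[R]_m (* only meaningful on dom *)
}.

Section Charts.
Context {R : realType} {T : Type} {m : nat}.
Implicit Types c d : chart R T m.

Definition codom c : set 'rV[R]_m := coord c @` dom c.

Definition overlap c d : set 'rV[R]_m := coord c @` (dom c `&` dom d).

(* The change of coordinates coord d \o (coord c)^-1 on overlap c d (and 0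
   outside of it). *)
Definition transition c d (u : 'rV[R]_m) : 'rV[R]_m :=
  xget 0 [set v | exists x, [/\ dom c x, dom d x, coord c x = u & coord d x = v]].

Definition compatible c d : Prop :=
  smooth_mx (overlap c d) (transition c d) /\
  smooth_mx (overlap d c) (transition d c).

(* A smooth tensor field of type (1, 1) on T, with respect to the charts (ch i)
   for i in A: (K i u) a b is the coefficient of du^a \otimes d/du^b in the
   coordinates u of the chart (ch i). *)
Definition tensor_field11 (I : Type) (A : set I) (ch : I -> chart R T m)
    (K : I -> 'rV[R]_m -> 'M[R]_m) : Prop :=
  (forall i, A i -> smooth_mx (codom (ch i)) (K i)) /\
  (forall i j u, A i -> A j -> overlap (ch i) (ch j) u ->
    let v := transition (ch i) (ch j) u in
    K j v = 'J (transition (ch j) (ch i)) v *m K i u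
              *m 'J (transition (ch i) (ch j)) u).

(* Same conventions for type (0, 2): (g c u) a b is the coefficient of
   du^a \otimes du^b. *)
Definition tensor_field02 (A : set (chart R T m))
    (g : chart R T m -> 'rV[R]_m -> 'M[R]_m) : Prop :=
  (forall c, A c -> smooth_mx (codom c) (g c)) /\
  (forall c d u, A c -> A d -> overlap c d u ->
    let v := transition c d u in
    g d v = 'J (transition d c) v *m g c u *m ('J (transition d c) v)^T).

End Charts.

(* A homeomorphism from an open set of T onto an open set of R^m. *)
Definition topological_chart (R : realType) (T : topologicalType) (m : nat)
    (c : chart R T m) : Prop :=
  [/\ open (dom c),
      {in dom c &, injective (coord c)},
      (forall x, dom c x -> {for x, continuous (coord c)}) &
      (forall U : set T, open U -> U `<=` dom c -> open (coord c @` U))].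

Record smooth_manifold (R : realType) (n : nat) := SmoothManifold {
  space :> topologicalType;
  space_hausdorff : hausdorff_space space;
  space_second_countable : @second_countable space;
  atlas : set (chart R space n);
  atlas_chart : forall c, atlas c -> topological_chart c;
  atlas_cover : forall x, exists2 c, atlas c & dom c x;
  atlas_compatible : forall c d, atlas c -> atlas d -> compatible c d;
  atlas_maximal : forall c, topological_chart c ->
    (forall d, atlas d -> compatible c d) -> atlas c
}.

Arguments atlas {R n} s _.

Section RealLine.
Variable R : realType.

Definition std_time : chart R R 1 := Chart setT (fun t : R => const_mx t).

(* The maximal atlas of the standard smooth structure of the real line. *)
Definition time_atlas : set (chart R R 1) :=
  [set s | topological_chart s /\ compatible s std_time].

End RealLine.

Section SemiRiemannian.
Context {R : realType} {n : nat}.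

Definition negative_definite_on (B W : 'M[R]_n) : Prop :=
  forall w : 'rV[R]_n, (w <= W)%MS -> w != 0 -> (w *m B *m w^T) 0 0 < 0.

(* The index of the symmetric bilinear form B is k: the largest dimension of a
   subspace on which B is negative definite. *)
Definition has_index (B : 'M[R]_n) (k : nat) : Prop :=
  (exists2 W : 'M[R]_n, negative_definite_on B W & \rank W = k) /\
  (forall W : 'M[R]_n, negative_definite_on B W -> (\rank W <= k)%N).

Definition semi_riemannian_metric (M : smooth_manifold R n)
    (phi : chart R M n -> 'rV[R]_n -> 'M[R]_n) : Prop :=
  tensor_field02 (atlas M) phi /\
  (forall c u, atlas M c -> codom c u ->
    (phi c u)^T = phi c u /\ phi c u \in unitmx) /\
  (exists k, forall c u, atlas M c -> codom c u -> has_index (phi c u) k).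

End SemiRiemannian.

Section DualJet.
Context {R : realType} {n : nat} (M : smooth_manifold R n).

(* An induced chart of the dual 1-jet space is labelled by a chart of the real
   line and a chart of M. *)
Definition jlabel := (chart R R 1 * chart R M n)%type.

Definition jatlas : set jlabel :=
  [set a | time_atlas a.1 /\ atlas M a.2].

(* The components p~ obtained from the components p at the point of
   coordinates (t, x) under the change of charts from a to b:
   p~_i = dx^j/dx~^i (dt~/dt) p_j. *)
Definition p_change (a b : jlabel) (t : 'rV[R]_1) (x p : 'rV[R]_n) : 'rV[R]_n :=
  \row_i \sum_j 'J (transition b.2 a.2) (transition a.2 b.2 x) i j
                * 'J (transition a.1 b.1) t 0 0 * p 0 j.

(* A point of J^{1*}(R, M): a point (t, x) of R x M with an element of
   T*_x M \otimes T_t R, the latter being given by its components in all the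
   charts around (t, x); jet_out makes the representation unique. *)
Record dual_jet := DualJet {
  jet_t : R;
  jet_x : M;
  jet_p : jlabel -> 'rV[R]_n;
  jet_out : forall a, ~ (jatlas a /\ dom a.1 jet_t /\ dom a.2 jet_x) ->
    jet_p a = 0;
  jet_law : forall a b,
    jatlas a -> dom a.1 jet_t -> dom a.2 jet_x ->
    jatlas b -> dom b.1 jet_t -> dom b.2 jet_x ->
    jet_p b = p_change a b (coord a.1 jet_t) (coord a.2 jet_x) (jet_p a)
}.

(* Coordinates (t, x^1, ..., x^n, p_1, ..., p_n). *)
Definition induced_chart (a : jlabel) : chart R dual_jet (1 + n + n) :=
  Chart [set z | dom a.1 (jet_t z) /\ dom a.2 (jet_x z)]
        (fun z => row_mx (row_mx (coord a.1 (jet_t z)) (coord a.2 (jet_x z)))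
                         (jet_p z a)).

Definition it : 'I_(1 + n + n) := lshift n (lshift n 0).
Definition ix (i : 'I_n) : 'I_(1 + n + n) := lshift n (rshift 1 i).
Definition ip (i : 'I_n) : 'I_(1 + n + n) := rshift (1 + n) i.

Definition tpart (u : 'rV[R]_(1 + n + n)) : 'rV[R]_1 := lsubmx (lsubmx u).
Definition xpart (u : 'rV[R]_(1 + n + n)) : 'rV[R]_n := rsubmx (lsubmx u).
Definition ppart (u : 'rV[R]_(1 + n + n)) : 'rV[R]_n := rsubmx u.

(* The change of coordinates (t, x, p) |-> (t~, x~, p~). *)
Definition jchange (a b : jlabel) (u : 'rV[R]_(1 + n + n)) :
    'rV[R]_(1 + n + n) :=
  row_mx (row_mx (transition a.1 b.1 (tpart u)) (transition a.2 b.2 (xpart u)))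
         (p_change a b (tpart u) (xpart u) (ppart u)).

(* A set of local functions with values in matrices: F a is read in the
   coordinates of the induced chart a. *)
Definition local_functions k l
    (F : jlabel -> 'rV[R]_(1 + n + n) -> 'M[R]_(k, l)) : Prop :=
  forall a, jatlas a -> smooth_mx (codom (induced_chart a)) (F a).

(* du^a \otimes d/du^b *)
Definition dtensor (a b : 'I_(1 + n + n)) : 'M[R]_(1 + n + n) := delta_mx a b.

(* In both cases, (G a u) j i is the component G_(j)i. *)
Definition temporal_semispray
    (G : jlabel -> 'rV[R]_(1 + n + n) -> 'M[R]_n) : Prop :=
  local_functions G /\
  exists K, tensor_field11 jatlas induced_chart K /\
    forall a u, jatlas a -> codom (induced_chart a) u ->
      K a u = \sum_i u 0 (ip i) *: dtensor (ix i) it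
              - 2 *: \sum_i \sum_j G a u j i *: dtensor (ix i) (ip j).

Definition spatial_semispray
    (G : jlabel -> 'rV[R]_(1 + n + n) -> 'M[R]_n) : Prop :=
  local_functions G /\
  exists K, tensor_field11 jatlas induced_chart K /\
    forall a u, jatlas a -> codom (induced_chart a) u ->
      K a u = \sum_i dtensor (ix i) (ix i)
              - 2 *: \sum_i \sum_j G a u j i *: dtensor (ix i) (ip j).

(* (N a u) 0 k is the component N_(k)1. *)
Definition temporal_nonlinear_connection
    (N : jlabel -> 'rV[R]_(1 + n + n) -> 'rV[R]_n) : Prop :=
  local_functions N /\
  forall a b u, jatlas a -> jatlas b ->
    overlap (induced_chart a) (induced_chart b) u ->
    let v := jchange a b u in
    forall j, N b v 0 j =
      \sum_k N a u 0 k * 'J (transition b.2 a.2) (xpart v) j k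
      - 'J (transition b.1 a.1) (tpart v) 0 0
        * pderiv (fun w => jchange a b w 0 (ip j)) it u.

(* (N a u) k i is the component N_(k)i. *)
Definition spatial_nonlinear_connection
    (N : jlabel -> 'rV[R]_(1 + n + n) -> 'M[R]_n) : Prop :=
  local_functions N /\
  forall a b u, jatlas a -> jatlas b ->
    overlap (induced_chart a) (induced_chart b) u ->
    let v := jchange a b u in
    forall j r, N b v j r =
      \sum_k \sum_i N a u k i * 'J (transition a.1 b.1) (tpart u) 0 0
                    * 'J (transition b.2 a.2) (xpart v) j k
                    * 'J (transition b.2 a.2) (xpart v) r i
      - \sum_i 'J (transition b.2 a.2) (xpart v) r i
               * pderiv (fun w => jchange a b w 0 (ip j)) (ix i) u.

End DualJet.

(* Main.v *)
(** The Jacobian of the change of coordinates (t, x, p) |-> (t~, x~, p~) is block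
    triangular, so conjugating the tensors of the required form with it shows
    that they are global exactly when the components G of the semispray satisfy
    one matrix identity.  Write X = dx/dx~ and c = dt~/dt.  The identity reads
      2 G~^T = X (2 c G^T X^T - p^T (dp~/dt))    in the temporal case,
      2 G~^T = X (2 c G^T X^T - dp~/dx)          in the spatial case,
    from which all the claims but the first are pure matrix algebra.  For the
    first one, dp~/dt is a multiple of p~ that depends on t only; hence, along a
    fibre, G~ is c X G X^T plus a quadratic form in p~ with constant coefficient,
    and its p~-derivative contracted with the metric is the transformation law
    of a temporal nonlinear connection. *)

Require Import Defs.
From HB Require Import structures.
From mathcomp Require Import all_boot all_order all_algebra.
From mathcomp Require Import all_classical all_reals all_analysis.
From mathcomp Require Import ring.

Set Implicit Arguments.
Unset Strict Implicit.
Unset Printing Implicit Defensive.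

Import Order.TTheory GRing.Theory Num.Theory.
Import numFieldNormedType.Exports.

Local Open Scope classical_set_scope.
Local Open Scope ring_scope.

(* The MathComp imports shadow [coord] and [codom] of Defs. *)
Import Defs.

(** * Calculus *)

Section Calculus.
Context {R : realType}.

(** The constants decide the first claim. Write k for the second derivative of t~ and c' = dt/dt~.
    In the identity for G~ the row p occurs only as p X^T = c' p~, and dp~/dt = k p X^T, so the
    quadratic term is (k c'^2 / 2) p~^T p~. Differentiating in p~_i gives two outer products;
    contracted with the inverse metric and lowered again, each returns p~. The half is thereby
    cancelled, and what remains, k c'^2 p~, is c' (dp~/dt), the correction in the law of a temporal
    nonlinear connection. Two facts about charts must be secured first. Differentiating along p~
    uses the identity for G~ on a whole fibre line, so the induced charts must fill their fibres:
    every row p has to be realised by a jet. And the p-components of a change of charts contain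
    Jacobians, so its differentiability asks for second derivatives of the base changes, including
    those between arbitrary charts of the line. *)

Lemma near_eq_differentiable (V W : normedModType R) (f g : V -> W) (x : V) :
  {near x, f =1 g} -> differentiable f x -> differentiable g x.
Proof.
move=> fg df.
have fgx : f x = g x := nbhs_singleton fg.
(* [g] inherits the first-order expansion of [f]; uniqueness of the differential then identifies
   ['d g x] with ['d f x]. *)
have dfE : g \o shift x = cst (g x) + 'd f x +o_ 0 id.
  apply/eqaddoP => e e0.
  have [_ /eqaddoP/(_ e e0)] := (diff_locallyP x f).1 df.
  have fg0 : \forall h \near (0 : V), f (h + x) = g (h + x).
    by move: fg; rewrite (near_shift 0 x); apply: filterS => h; rewrite /= subr0.
  by apply: filterS2 fg0 => h fgh; rewrite !fctE /= fgh fgx.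
have cdf : continuous ('d f x) by exact: diff_continuous.
apply/diff_locallyP.
by have -> : 'd g x = 'd f x :> (V -> W) by exact: diff_unique.
Qed.

Lemma differentiable_mxP (V : normedModType R) m n (f : V -> 'M[R]_(m, n)) (x : V) :
  differentiable f x <-> forall i j, differentiable (fun w => f w i j) x.
Proof.
split=> [df i j|df].
  exact: (differentiable_comp df (differentiable_coord (f x) i j)).
have -> : f = \sum_(i < m) \sum_(j < n) (fun w => f w i j *: delta_mx i j).
  apply/funext => w; rewrite fct_sumE [LHS]matrix_sum_delta.
  by apply: eq_bigr => i _; rewrite fct_sumE.
apply: differentiable_sum => i /=.
apply: differentiable_sum => j.
exact: differentiableZl (df i j).
Qed.

Lemma jacobianE m n (f : 'rV[R]_m -> 'rV[R]_n) (u : 'rV[R]_m) i j :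
  differentiable f u -> 'J f u i j = pderiv (fun w => f w 0 j) i u.
Proof.
move=> df; rewrite /pderiv.
transitivity (('D_(delta_mx 0 i) f u) 0 j); last first.
  by rewrite derive_mx ?mxE // => *; exact: diff_derivable.
by rewrite deriveEjacobian // -rowE [RHS]mxE.
Qed.



Lemma near_eq_pderiv m (f g : 'rV[R]_m -> R) i (u : 'rV[R]_m) :
  {near u, f =1 g} -> pderiv f i u = pderiv g i u.
Proof. exact: near_eq_derive. Qed.

Lemma near_eq_jacobian m n (f g : 'rV[R]_m -> 'rV[R]_n) (u : 'rV[R]_m) :
  {near u, f =1 g} -> differentiable f u -> 'J f u = 'J g u.
Proof.
move=> fg df; have dg := near_eq_differentiable fg df.
apply/matrixP => i j.
transitivity (pderiv (fun w => f w 0 j) i u); first exact: jacobianE.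
transitivity (pderiv (fun w => g w 0 j) i u); last by apply: esym; exact: jacobianE.
apply: near_eq_pderiv.
by apply: filterS fg => w ->.
Qed.

Lemma jacobian_comp m n p (f : 'rV[R]_m -> 'rV[R]_n) (g : 'rV[R]_n -> 'rV[R]_p)
    (u : 'rV[R]_m) :
  differentiable f u -> differentiable g (f u) ->
  'J (g \o f) u = 'J f u *m 'J g (f u).
Proof.
move=> df dg; apply/row_matrixP => i.
rewrite row_mul !rowE -!deriveEjacobian //; last exact: differentiable_comp.
rewrite !deriveE //; last exact: differentiable_comp.
by rewrite diff_comp.
Qed.

Lemma jacobian_id m (u : 'rV[R]_m) : 'J id u = 1%:M.
Proof.
apply/row_matrixP => i; rewrite !rowE mulmx1 -deriveEjacobian //.
exact: derive_id.
Qed.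

Lemma derive_pderiv m (f : 'rV[R]_m -> R) (u v : 'rV[R]_m) :
  differentiable f u -> 'D_v f u = \sum_i v 0 i * pderiv f i u.
Proof.
move=> df; rewrite deriveE // {1}[v]row_sum_delta linear_sum.
by apply: eq_bigr => i _; rewrite linearZ /pderiv deriveE.
Qed.

Lemma derive_coord m n (u v : 'M[R]_(m, n)) i j :
  'D_v (fun w : 'M[R]_(m, n) => w i j) u = v i j.
Proof.
have /matrixP/(_ i j) := derive_mx (@derivable_id _ _ u v).
by rewrite derive_id mxE => ->.
Qed.

(** A directional derivative sees only the values along one line, so maps on different spaces can be
    compared, and no differentiability is assumed. This replaces the chain rule for linear inner
    maps and along fibres. *)
Lemma derive_line (U V W : normedModType R) (f : U -> W) (g : V -> W) u v du dv :
  (forall h : R, f (h *: du + u) = g (h *: dv + v)) -> 'D_du f u = 'D_dv g v.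
Proof.
move=> fg; rewrite /derive.
have fgu : f u = g v by have := fg 0; rewrite !scale0r !add0r.
by under eq_fun do rewrite /= fg fgu.
Qed.

Lemma derive_comp_linear (U V W : normedModType R) (L : {linear U -> V})
    (f : V -> W) u du : 'D_du (f \o L) u = 'D_(L du) f (L u).
Proof. by apply: derive_line => h /=; rewrite linearD linearZ. Qed.

End Calculus.

(** * Closure properties of smooth functions *)

Section SmoothFunctions.
Context {R : realType} {m : nat}.
Implicit Types (A B : set 'rV[R]_m) (f g : 'rV[R]_m -> R).

Lemma open_near A u (P : set 'rV[R]_m) :
  open A -> A u -> (forall w, A w -> P w) -> \forall w \near u, P w.
Proof. by move=> oA Au AP; apply: (filterS AP); exact: open_nbhs_nbhs. Qed.

(** The rules for derivatives of sums, products and inverses hold only at points of [A]; openness of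
    [A] lets such equalities be differentiated again, which the inductions on [k] below rely on. *)
Lemma ndiff_eq k A f g : open A -> (forall u, A u -> f u = g u) ->
  ndiff k A f -> ndiff k A g.
Proof.
move=> oA; elim: k f g => [|k IHk] f g fg [df nf]; split=> //.
- by move=> u Au; apply: near_eq_differentiable (df u Au); exact: open_near fg.
- by move=> u Au; apply: near_eq_differentiable (df u Au); exact: open_near fg.
- move=> i; apply: IHk (nf i) => u Au.
  by apply: near_eq_pderiv; exact: open_near fg.
Qed.

Lemma ndiffW k A f : ndiff k.+1 A f -> ndiff k A f.
Proof.
elim: k f => [|k IHk] f [df nf]; split=> // i.
exact: IHk.
Qed.

Lemma ndiff_cst k A (c : R) : ndiff k A (fun=> c).
Proof.
elim: k c => [|k IHk] c; split=> //.
move=> i; have -> : pderiv (fun=> c) i = fun=> 0 :> R.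
  by apply/funext => u; exact: derive_cst.
exact: IHk.
Qed.

Lemma ndiffD k A f g : open A -> ndiff k A f -> ndiff k A g ->
  ndiff k A (fun u => f u + g u).
Proof.
move=> oA; elim: k f g => [|k IHk] f g [df nf] [dg ng]; split=> //.
- by move=> u Au; apply: differentiableD; [exact: df|exact: dg].
- by move=> u Au; apply: differentiableD; [exact: df|exact: dg].
- move=> i; apply: ndiff_eq (IHk _ _ (nf i) (ng i)) => // u Au.
  rewrite /pderiv -deriveD //; apply: diff_derivable; [exact: df|exact: dg].
Qed.

Lemma ndiffM k A f g : open A -> ndiff k A f -> ndiff k A g ->
  ndiff k A (fun u => f u * g u).
Proof.
move=> oA; elim: k f g => [|k IHk] f g nf ng; split=> //.
- by move=> u Au; apply: differentiableM; [exact: nf.1|exact: ng.1].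
- by move=> u Au; apply: differentiableM; [exact: nf.1|exact: ng.1].
- move=> i.
  have nfg := IHk _ _ (ndiffW nf) (ng.2 i).
  have ngf := IHk _ _ (ndiffW ng) (nf.2 i).
  apply: ndiff_eq (ndiffD oA nfg ngf) => // u Au.
  have dfu : derivable _ u (delta_mx 0 i) := diff_derivable (nf.1 u Au).
  have dgu : derivable _ u (delta_mx 0 i) := diff_derivable (ng.1 u Au).
  by rewrite /pderiv (deriveM dfu dgu).
Qed.

Lemma ndiffV k A f : open A -> (forall u, A u -> f u != 0) -> ndiff k A f ->
  ndiff k A (fun u => (f u)^-1).
Proof.
move=> oA f0; elim: k => [|k IHk] nf; split=> //.
- by move=> u Au; apply: differentiableV; [exact: nf.1|exact: f0].
- by move=> u Au; apply: differentiableV; [exact: nf.1|exact: f0].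
- move=> i; have nV := IHk (ndiffW nf).
  (* The derivative of 1/f is -f' (1/f)^2, so the induction hypothesis on 1/f itself suffices. *)
  have n2 := ndiffM oA (ndiffM oA (ndiff_cst k A (-1)) (nf.2 i)) (ndiffM oA nV nV).
  apply: ndiff_eq n2 => // u Au.
  have dfu : derivable _ u (delta_mx 0 i) := diff_derivable (nf.1 u Au).
  rewrite /pderiv (deriveV (f0 _ Au) dfu).
  rewrite /GRing.scale /= -exprVn expr2; ring.
Qed.

Lemma smooth_eq A f g : open A -> (forall u, A u -> f u = g u) ->
  smooth A f -> smooth A g.
Proof. by move=> oA fg sf k; exact: ndiff_eq (sf k). Qed.

Lemma smooth_cst A (c : R) : smooth A (fun=> c).
Proof. by move=> k; exact: ndiff_cst. Qed.

Lemma smoothD A f g : open A -> smooth A f -> smooth A g ->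
  smooth A (fun u => f u + g u).
Proof. by move=> oA sf sg k; exact: ndiffD. Qed.

Lemma smoothM A f g : open A -> smooth A f -> smooth A g ->
  smooth A (fun u => f u * g u).
Proof. by move=> oA sf sg k; exact: ndiffM. Qed.

Lemma smoothV A f : open A -> (forall u, A u -> f u != 0) -> smooth A f ->
  smooth A (fun u => (f u)^-1).
Proof. by move=> oA f0 sf k; exact: ndiffV. Qed.

Lemma smooth_sum A I (r : seq I) (P : pred I) (F : I -> 'rV[R]_m -> R) :
  open A -> (forall i, P i -> smooth A (F i)) ->
  smooth A (fun u => \sum_(i <- r | P i) F i u).
Proof.
move=> oA sF; elim: r => [|i r IHr].
  by under eq_fun do rewrite big_nil; exact: smooth_cst.
under eq_fun do rewrite big_cons.
by case Pi: (P i) => //; apply: smoothD => //; exact: sF.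
Qed.

Lemma smooth_prod A I (r : seq I) (P : pred I) (F : I -> 'rV[R]_m -> R) :
  open A -> (forall i, P i -> smooth A (F i)) ->
  smooth A (fun u => \prod_(i <- r | P i) F i u).
Proof.
move=> oA sF; elim: r => [|i r IHr].
  by under eq_fun do rewrite big_nil; exact: smooth_cst.
under eq_fun do rewrite big_cons.
by case Pi: (P i) => //; apply: smoothM => //; exact: sF.
Qed.

Lemma smooth_differentiable A f u : smooth A f -> A u -> differentiable f u.
Proof. by move=> sf Au; exact: (sf 0%N).1. Qed.

Lemma smooth_pderiv A f i : smooth A f -> smooth A (pderiv f i).
Proof. by move=> sf k; exact: (sf k.+1).2. Qed.

Lemma smooth_coord A (i : 'I_m) : smooth A (fun u => u 0 i).
Proof.
case=> [|k]; split=> //; try by move=> u _; exact: differentiable_coord.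
move=> j; rewrite [pderiv _ _](_ : _ = fun=> (j == i)%:R); last first.
  by apply/funext => u; rewrite /pderiv derive_coord mxE eqxx eq_sym.
exact: ndiff_cst.
Qed.

Lemma smooth_det A p (F : 'rV[R]_m -> 'M[R]_p) :
  open A -> smooth_mx A F -> smooth A (fun u => \det (F u)).
Proof.
move=> oA sF; apply: smooth_sum => // s _; apply: smoothM => //.
  exact: smooth_cst.
by apply: smooth_prod => // i _; exact: sF.
Qed.

Lemma smooth_invmx A p (F : 'rV[R]_m -> 'M[R]_p) : open A ->
  (forall u, A u -> F u \in unitmx) -> smooth_mx A F ->
  smooth_mx A (fun u => invmx (F u)).
Proof.
move=> oA uF sF i j.
have sV : smooth A (fun u => (\det (F u))^-1 * ((-1) ^+ (j + i) *
    \det (row' j (col' i (F u))))).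
  apply: smoothM => //.
    apply: smoothV => //; last exact: smooth_det.
    by move=> u Au; rewrite -unitfE -unitmxE uF.
  apply: smoothM => //; first exact: smooth_cst.
  apply: smooth_det => // k l.
  by under eq_fun do rewrite !mxE; exact: sF.
apply: smooth_eq sV => // u Au.
by rewrite /invmx uF // !mxE.
Qed.

End SmoothFunctions.

(** The partial derivatives of [f \o L] are combinations of the [pderiv f b \o L] with constant
    coefficients, so the induction closes without a higher-order chain rule. *)
Lemma smooth_comp_linear (R : realType) m p (A : set 'rV[R]_p) (B : set 'rV[R]_m)
    (L : {linear 'rV[R]_m -> 'rV[R]_p}) (f : 'rV[R]_p -> R) :
  continuous L -> open B -> (forall u, B u -> A (L u)) ->
  smooth A f -> smooth B (f \o L).
Proof.
move=> cL oB BA sf k; elim: k f sf => [|k IHk] f sf; split=> //.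
- move=> u Bu; apply: differentiable_comp; first exact: linear_differentiable.
  exact: smooth_differentiable sf (BA u Bu).
- move=> u Bu; apply: differentiable_comp; first exact: linear_differentiable.
  exact: smooth_differentiable sf (BA u Bu).
move=> i.
have sum_ndiff (r : seq 'I_p) : ndiff k B
    (fun u => \sum_(b <- r) L (delta_mx 0 i) 0 b * pderiv f b (L u)).
  elim: r => [|b r IHr].
    by under eq_fun do rewrite big_nil; exact: ndiff_cst.
  under eq_fun do rewrite big_cons.
  apply: ndiffD => //; apply: ndiffM => //; first exact: ndiff_cst.
  by apply: (IHk (pderiv f b)); exact: smooth_pderiv.
apply: ndiff_eq (sum_ndiff (index_enum _)) => // u Bu.
rewrite /pderiv derive_comp_linear derive_pderiv //.
exact: smooth_differentiable sf (BA u Bu).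
Qed.

(** * Changes of charts *)

Section Charts.
Context {R : realType} {T : Type} {m : nat}.
Implicit Types c d e : chart R T m.

Lemma transitionE c d x : {in dom c &, injective (coord c)} ->
  dom c x -> dom d x -> transition c d (coord c x) = coord d x.
Proof.
move=> injc cx dx; rewrite /transition.
have /(xgetPex 0)[y [cy dy cyx <-]] : exists v, [set v | exists y,
    [/\ dom c y, dom d y, coord c y = coord c x & coord d y = v]] v.
  by exists (coord d x); exists x.
by have -> : y = x by apply: injc; rewrite ?inE.
Qed.

Lemma smooth_mx_differentiable p q (A : set 'rV[R]_m) (F : 'rV[R]_m -> 'M[R]_(p, q)) u :
  smooth_mx A F -> A u -> differentiable F u.
Proof.
move=> sF Au; apply/differentiable_mxP => i j.
exact: smooth_differentiable (sF i j) Au.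
Qed.

Lemma smooth_jacobian p (A : set 'rV[R]_m) (F : 'rV[R]_m -> 'rV[R]_p) i j :
  open A -> smooth_mx A F -> smooth A (fun u => 'J F u i j).
Proof.
move=> oA sF; apply: smooth_eq (smooth_pderiv i (sF 0 j)) => // u Au.
by rewrite jacobianE //; exact: smooth_mx_differentiable sF Au.
Qed.

End Charts.

(** * Atlases with twice differentiable changes of charts *)

Section RegularAtlas.
Context {R : realType} {T : topologicalType} {m : nat}.
Implicit Types (c d e : chart R T m) (S : set (chart R T m)).

(* The changes of charts are twice differentiable, in the form in which this is
   needed: for charts of the line it follows from compatibility with the
   standard chart without composing smooth maps. *)
Definition regular_atlas S : Prop :=
  (forall c, S c -> topological_chart c) /\
  (forall c d u, S c -> S d -> overlap c d u ->
    differentiable (transition c d) u /\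
    forall i j, differentiable (fun w => 'J (transition c d) w i j) u).

Lemma open_coord_image c U : topological_chart c -> open U -> U `<=` dom c ->
  open (coord c @` U).
Proof. by case=> _ _ _; apply. Qed.

Lemma open_overlap c d : topological_chart c -> topological_chart d ->
  open (overlap c d).
Proof.
move=> tc td; apply: open_coord_image => //.
by apply: openI; [case: tc|case: td].
Qed.

Variables (S : set (chart R T m)) (regS : regular_atlas S).

Lemma regular_transitionE c d x : S c -> dom c x -> dom d x ->
  transition c d (coord c x) = coord d x.
Proof. by move=> /regS.1[_ injc _ _]; exact: transitionE. Qed.

Lemma regular_differentiable c d x : S c -> S d -> dom c x -> dom d x ->
  differentiable (transition c d) (coord c x).
Proof. by move=> Sc Sd cx dx; apply: (regS.2 _ _ _ Sc Sd _).1; exists x. Qed.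

Lemma jacobian_transition_comp c d e x : S c -> S d -> S e ->
  dom c x -> dom d x -> dom e x ->
  'J (transition c e) (coord c x) =
  'J (transition c d) (coord c x) *m 'J (transition d e) (coord d x).
Proof.
move=> Sc Sd Se cx dx ex.
have cde := regular_transitionE Sc cx dx.
have dcd := regular_differentiable Sc Sd cx dx.
have dde : differentiable (transition d e) (transition c d (coord c x)).
  by rewrite cde; exact: regular_differentiable.
have := jacobian_comp dcd dde; rewrite cde => <-.
apply: near_eq_jacobian; last exact: regular_differentiable.
(* The composite is known to agree with [transition c e] only over the triple intersection, so its
   image must be a neighbourhood of [coord c x]. *)
have oU : open (coord c @` (dom c `&` dom d `&` dom e)).
  apply: open_coord_image; [exact: regS.1| |by move=> y [[]]].
  by do 2?apply: openI; [case: (regS.1 c Sc)|case: (regS.1 d Sd)|case: (regS.1 e Se)].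
apply: (open_near oU); first by exists x.
by move=> _ [y [[cy dy] ey] <-] /=; rewrite !regular_transitionE.
Qed.

Lemma jacobian_transition_refl c x : S c -> dom c x ->
  'J (transition c c) (coord c x) = 1%:M.
Proof.
move=> Sc cx; rewrite -(jacobian_id (coord c x)).
apply: near_eq_jacobian; last exact: regular_differentiable.
have oU : open (coord c @` dom c).
  by apply: open_coord_image => //; [exact: regS.1|case: (regS.1 c Sc)].
apply: (open_near oU); first by exists x.
by move=> _ [y cy <-]; rewrite regular_transitionE.
Qed.

Lemma jacobian_transition_inv c d x : S c -> S d -> dom c x -> dom d x ->
  'J (transition c d) (coord c x) *m 'J (transition d c) (coord d x) = 1%:M.
Proof.
move=> Sc Sd cx dx; rewrite -jacobian_transition_comp //.
exact: jacobian_transition_refl.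
Qed.

End RegularAtlas.

Lemma regular_manifold (R : realType) n (M : smooth_manifold R n) :
  regular_atlas (atlas M).
Proof.
split=> [c|c d u Mc Md cdu]; first exact: atlas_chart.
have ocd : open (overlap c d) by apply: open_overlap; exact: atlas_chart.
have [scd _] := atlas_compatible Mc Md.
split=> [|i j]; first exact: smooth_mx_differentiable scd cdu.
exact: smooth_differentiable (smooth_jacobian i j ocd scd) cdu.
Qed.

(** Charts in [time_atlas] are given as compatible with [std_time] alone, so [transition c d] is
    factored through it on [overlap c d]. The entries of its Jacobian are then sums of products of
    Jacobian entries of two smooth maps, one of them precomposed with a differentiable map. *)
Lemma regular_line (R : realType) : regular_atlas (@time_atlas R).
Proof.
split=> [c []//|c d u [tc [scs _]] [td [_ ssd]] cdu].
set s := std_time R in scs ssd.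
have injs : {in dom s &, injective (coord s)}.
  by move=> x y _ _ /matrixP/(_ 0 0); rewrite !mxE.
have [[_ injc _ _] [od _ _ _]] := (tc, td).
have ocs : open (overlap c s).
  by apply: (open_coord_image tc); [rewrite setIT; case: tc|move=> x []].
have osd : open (overlap s d).
  (* Every real number lies in the domain of the standard chart, so this overlap is just [dom d]
     read through the single coordinate. *)
  have -> : overlap s d = (fun v : 'rV[R]_1 => v 0 0) @^-1` dom d.
    apply/seteqP; split=> [_ [t [_ dt] <-]|v dv] /=; first by rewrite mxE.
    exists (v 0 0) => //; apply/rowP => i.
    by rewrite mxE !ord1.
  apply: open_comp => // v _; exact: coord_continuous.
have ocd := open_overlap tc td.
have cs w : overlap c d w -> overlap c s w by move=> [x [cx dx] <-]; exists x.
have sd w : overlap c d w -> overlap s d (transition c s w).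
  by move=> [x [cx dx] <-]; rewrite transitionE //; exists x.
have csd w : overlap c d w -> transition s d (transition c s w) = transition c d w.
  by move=> [x [cx dx] <-]; rewrite !transitionE.
have dcs w : overlap c d w -> differentiable (transition c s) w.
  by move=> cdw; exact: smooth_mx_differentiable scs (cs w cdw).
have dsd w : overlap c d w -> differentiable (transition s d) (transition c s w).
  by move=> cdw; exact: smooth_mx_differentiable ssd (sd w cdw).
have dcomp w : overlap c d w -> differentiable (transition s d \o transition c s) w.
  by move=> cdw; apply: differentiable_comp; [exact: dcs|exact: dsd].
split=> [|i j].
  by apply: near_eq_differentiable (dcomp u cdu); exact: open_near csd.
pose g w := \sum_k 'J (transition c s) w i k * 'J (transition s d) (transition c s w) k j.
have gE w : overlap c d w -> g w = 'J (transition c d) w i j.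
  move=> cdw; transitivity (('J (transition s d \o transition c s) w) i j).
    by rewrite jacobian_comp ?mxE //; [exact: dcs|exact: dsd].
  have /matrixP/(_ i j) // := near_eq_jacobian (open_near ocd cdw csd) (dcomp w cdw).
apply: (@near_eq_differentiable _ _ _ g); first exact: open_near gE.
have -> : g = \sum_(k < 1) ((fun w => 'J (transition c s) w i k) *
    ((fun v => 'J (transition s d) v k j) \o transition c s)).
  by apply/funext => w; rewrite fct_sumE.
apply: differentiable_sum => k; apply: differentiableM.
  exact: smooth_differentiable (smooth_jacobian i k ocs scs) (cs u cdu).
apply: differentiable_comp; first exact: dcs.
exact: smooth_differentiable (smooth_jacobian k j osd ssd) (sd u cdu).
Qed.

Section TimeCharts.
Context {R : realType}.
Implicit Types a b c : chart R R 1.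

Lemma time_transitionE a b t : time_atlas a -> dom a t -> dom b t ->
  transition a b (coord a t) = coord b t.
Proof. exact: (regular_transitionE (regular_line R)). Qed.

Lemma time_jacobian_comp a b c t : time_atlas a -> time_atlas b -> time_atlas c ->
  dom a t -> dom b t -> dom c t ->
  'J (transition a c) (coord a t) =
  'J (transition a b) (coord a t) *m 'J (transition b c) (coord b t).
Proof. exact: (jacobian_transition_comp (regular_line R)). Qed.

Lemma time_jacobian_refl a t : time_atlas a -> dom a t ->
  'J (transition a a) (coord a t) = 1%:M.
Proof. exact: (jacobian_transition_refl (regular_line R)). Qed.

End TimeCharts.

(** * The dual jet space *)

Section DualJet.
Context {R : realType} {n : nat} {M : smooth_manifold R n}.
Implicit Types (a b c : jlabel M) (u v w : 'rV[R]_(1 + n + n)) (p : 'rV[R]_n).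

Local Notation regR := (regular_line R).
Local Notation regM := (regular_manifold M).

Lemma p_changeE a b t x p : p_change a b t x p = 'J (transition a.1 b.1) t 0 0 *:
  (p *m ('J (transition b.2 a.2) (transition a.2 b.2 x))^T).
Proof.
apply/rowP => i; rewrite !mxE big_distrr /=; apply: eq_bigr => j _.
rewrite [in RHS]mxE; ring.
Qed.

(** The cocycle condition of the bundle with fibre T*M tensor TR: time Jacobians compose in the
    direction of the change, space Jacobians in the opposite one, and the transpose restores the
    order. *)
Lemma p_change_comp a b c t0 x0 p :
  jatlas a -> jatlas b -> jatlas c -> dom a.1 t0 -> dom a.2 x0 ->
  dom b.1 t0 -> dom b.2 x0 -> dom c.1 t0 -> dom c.2 x0 ->
  p_change b c (coord b.1 t0) (coord b.2 x0)
    (p_change a b (coord a.1 t0) (coord a.2 x0) p) =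
  p_change a c (coord a.1 t0) (coord a.2 x0) p.
Proof.
move=> [a1 a2] [b1 b2] [c1 c2] at0 ax0 bt0 bx0 ct0 cx0.
rewrite !p_changeE (regular_transitionE regM b2 bx0 cx0).
rewrite (regular_transitionE regM a2 ax0 bx0) (regular_transitionE regM a2 ax0 cx0).
rewrite -> (time_jacobian_comp a1 b1 c1 at0 bt0 ct0).
rewrite -> (jacobian_transition_comp regM c2 b2 a2 cx0 bx0 ax0).
have mul_scale (A B : 'M[R]_1) (X Y : 'M[R]_n) :
    B 0 0 *: ((A 0 0 *: (p *m X^T)) *m Y^T) = (A *m B) 0 0 *: (p *m (Y *m X)^T).
  by rewrite trmx_mul mulmxA -scalemxAl scalerA mxE big_ord1 mulrC.
exact: mul_scale.
Qed.

Lemma p_change_refl a t0 x0 p : jatlas a -> dom a.1 t0 -> dom a.2 x0 ->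
  p_change a a (coord a.1 t0) (coord a.2 x0) p = p.
Proof.
move=> [a1 a2] at0 ax0; rewrite p_changeE (regular_transitionE regM a2 ax0 ax0).
rewrite -> (time_jacobian_refl a1 at0).
rewrite -> (jacobian_transition_refl regM a2 ax0).
by rewrite trmx1 mulmx1 mxE eqxx scale1r.
Qed.

(** By the cocycle condition, components prescribed in one chart determine consistent components in
    all others. Hence overlaps of induced charts restrict t and x but not p. *)
Lemma dual_jet_exists a t0 x0 p : jatlas a -> dom a.1 t0 -> dom a.2 x0 ->
  exists z : dual_jet M, [/\ jet_t z = t0, jet_x z = x0 & jet_p z a = p].
Proof.
move=> aa at0 ax0.
pose around b := jatlas b /\ dom b.1 t0 /\ dom b.2 x0.
(* The value 0 off the charts around the point is the one that [jet_out] forces. *)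
pose P b := if pselect (around b) is left _
  then p_change a b (coord a.1 t0) (coord a.2 x0) p else 0.
have PE b : around b -> P b = p_change a b (coord a.1 t0) (coord a.2 x0) p.
  by rewrite /P; case: pselect.
have Pout b : ~ around b -> P b = 0 by rewrite /P; case: pselect.
have Plaw b c : jatlas b -> dom b.1 t0 -> dom b.2 x0 ->
    jatlas c -> dom c.1 t0 -> dom c.2 x0 ->
    P c = p_change b c (coord b.1 t0) (coord b.2 x0) (P b).
  by move=> *; rewrite !PE // p_change_comp.
exists (DualJet Pout Plaw); split=> //=.
by rewrite PE // p_change_refl.
Qed.

Lemma tpart_row_mx (t : 'rV[R]_1) (x p : 'rV[R]_n) : tpart (row_mx (row_mx t x) p) = t.
Proof. by rewrite /tpart !row_mxKl. Qed.

Lemma xpart_row_mx (t : 'rV[R]_1) (x p : 'rV[R]_n) : xpart (row_mx (row_mx t x) p) = x.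
Proof. by rewrite /xpart row_mxKl row_mxKr. Qed.

Lemma ppart_row_mx (t : 'rV[R]_1) (x p : 'rV[R]_n) : ppart (row_mx (row_mx t x) p) = p.
Proof. by rewrite /ppart row_mxKr. Qed.

Lemma row_mx_parts u : row_mx (row_mx (tpart u) (xpart u)) (ppart u) = u.
Proof. by rewrite /tpart /xpart /ppart !hsubmxK. Qed.

Lemma overlap_inducedE a b : jatlas a -> overlap (induced_chart a) (induced_chart b) =
  [set u | overlap a.1 b.1 (tpart u) /\ overlap a.2 b.2 (xpart u)].
Proof.
move=> aa; apply/seteqP; split=> [_ [z [[at0 ax0] [bt0 bx0]] <-] /=|u].
  rewrite tpart_row_mx xpart_row_mx.
  by split; [exists (jet_t z)|exists (jet_x z)].
move=> [[t0 [at0 bt0] tu] [x0 [ax0 bx0] xu]].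
have [z [zt zx zp]] := dual_jet_exists (ppart u) aa at0 ax0.
exists z; first by rewrite /= zt zx.
by rewrite /= zt zx zp tu xu row_mx_parts.
Qed.

Lemma codom_overlap T m (c : chart R T m) : codom c = overlap c c.
Proof. by rewrite /overlap setIid. Qed.

Lemma codom_inducedE a : jatlas a -> codom (induced_chart a) =
  [set u | codom a.1 (tpart u) /\ codom a.2 (xpart u)].
Proof. by move=> aa; rewrite !codom_overlap overlap_inducedE. Qed.

Lemma tpart_is_linear : linear (@tpart R n).
Proof. by move=> k u v; rewrite /tpart !linearP. Qed.

Lemma xpart_is_linear : linear (@xpart R n).
Proof. by move=> k u v; rewrite /xpart !linearP. Qed.

HB.instance Definition _ := GRing.isLinear.Build R 'rV[R]_(1 + n + n) 'rV[R]_1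
  _ (@tpart R n) tpart_is_linear.

HB.instance Definition _ := GRing.isLinear.Build R 'rV[R]_(1 + n + n) 'rV[R]_n
  _ (@xpart R n) xpart_is_linear.

Lemma continuous_tpart : continuous (@tpart R n).
Proof.
move=> u; apply: (@continuous_comp _ _ _ lsubmx lsubmx); exact: continuous_lsubmx.
Qed.

Lemma continuous_xpart : continuous (@xpart R n).
Proof.
move=> u; apply: (@continuous_comp _ _ _ lsubmx rsubmx).
  exact: continuous_lsubmx.
exact: continuous_rsubmx.
Qed.

Lemma tpart_delta_it : tpart (delta_mx 0 it : 'rV[R]_(1 + n + n)) = delta_mx 0 0.
Proof.
apply/rowP => i; rewrite !mxE (inj_eq (@lshift_inj _ _)) (inj_eq (@lshift_inj _ _)).
by rewrite ord1.
Qed.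

Lemma tpart_delta_ix i : tpart (delta_mx 0 (ix i) : 'rV[R]_(1 + n + n)) = 0.
Proof.
by apply/rowP => j; rewrite !mxE (inj_eq (@lshift_inj _ _)) eq_lrshift andbF.
Qed.

Lemma tpart_delta_ip i : tpart (delta_mx 0 (ip i) : 'rV[R]_(1 + n + n)) = 0.
Proof. by apply/rowP => j; rewrite !mxE eq_lrshift andbF. Qed.

Lemma xpart_delta_it : xpart (delta_mx 0 it : 'rV[R]_(1 + n + n)) = 0.
Proof.
by apply/rowP => j; rewrite !mxE (inj_eq (@lshift_inj _ _)) eq_rlshift andbF.
Qed.

Lemma xpart_delta_ix i :
  xpart (delta_mx 0 (ix i) : 'rV[R]_(1 + n + n)) = delta_mx 0 i.
Proof.
apply/rowP => j.
by rewrite !mxE (inj_eq (@lshift_inj _ _)) (inj_eq (@rshift_inj _ _)).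
Qed.

Lemma xpart_delta_ip i : xpart (delta_mx 0 (ip i) : 'rV[R]_(1 + n + n)) = 0.
Proof. by apply/rowP => j; rewrite !mxE eq_lrshift andbF. Qed.

Lemma open_overlap_induced a b : jatlas a -> jatlas b ->
  open (overlap (induced_chart a) (induced_chart b)).
Proof.
move=> aa [b1 b2]; rewrite overlap_inducedE //.
have [[a1 _] [tb1 _]] := (aa.1, b1).
have oR := open_overlap a1 tb1.
have oM := open_overlap (atlas_chart aa.2) (atlas_chart b2).
apply: openI; apply: open_comp => // u _.
- exact: continuous_tpart.
- exact: continuous_xpart.
Qed.

Lemma open_codom_induced a : jatlas a -> open (codom (induced_chart a)).
Proof. by move=> aa; rewrite codom_overlap; exact: open_overlap_induced. Qed.

Lemma jchange_coord a b z : jatlas a -> jatlas b ->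
  dom (induced_chart a) z -> dom (induced_chart b) z ->
  jchange a b (coord (induced_chart a) z) = coord (induced_chart b) z.
Proof.
move=> aa bb [at0 ax0] [bt0 bx0].
rewrite /= /jchange tpart_row_mx xpart_row_mx ppart_row_mx.
have [[a1 a2] [b1 b2]] := (aa, bb).
rewrite (time_transitionE a1 at0 bt0) (regular_transitionE regM a2 ax0 bx0).
by rewrite -(jet_law aa at0 ax0 bb bt0 bx0).
Qed.

Lemma transition_inducedE a b u : jatlas a -> jatlas b ->
  overlap (induced_chart a) (induced_chart b) u ->
  transition (induced_chart a) (induced_chart b) u = jchange a b u.
Proof.
move=> aa bb [z0 abz0 <-]; rewrite /transition.
set Q := [set v | _].
have /(xgetPex 0)[z [[at0 ax0] [bt0 bx0] zz0 <-]] : exists v, Q v.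
  by exists (coord (induced_chart b) z0), z0; case: abz0.
by rewrite -zz0; apply: esym; exact: jchange_coord.
Qed.

End DualJet.

(** * Jacobian of the induced change of coordinates *)

Section JetJacobian.
Context {R : realType} {n : nat} {M : smooth_manifold R n}.
Implicit Types (a b c : jlabel M) (u v w : 'rV[R]_(1 + n + n)) (p : 'rV[R]_n).

Lemma jindexP (P : 'I_(1 + n + n) -> Prop) :
  P it -> (forall i, P (ix i)) -> (forall i, P (ip i)) -> forall k, P k.
Proof.
move=> Pt Px Pp k; case: (split_ordP k) => [l ->|i ->]; last exact: Pp.
case: (split_ordP l) => [i ->|i ->]; last exact: Px.
by rewrite (ord1 i); exact: Pt.
Qed.

Lemma jchange_it a b w : jchange a b w 0 it = transition a.1 b.1 (tpart w) 0 0.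
Proof. by rewrite /jchange !row_mxEl. Qed.

Lemma jchange_ix a b w i :
  jchange a b w 0 (ix i) = transition a.2 b.2 (xpart w) 0 i.
Proof. by rewrite /jchange row_mxEl row_mxEr. Qed.

Lemma jchange_ip a b w i :
  jchange a b w 0 (ip i) = p_change a b (tpart w) (xpart w) (ppart w) 0 i.
Proof. by rewrite /jchange row_mxEr. Qed.

(** The fibre components contain ['J (transition a.1 b.1)] and, composed with [transition a.2 b.2],
    the entries of ['J (transition b.2 a.2)]; this is where the second half of [regular_atlas] is
    consumed. *)
Lemma differentiable_jchange a b u : jatlas a -> jatlas b ->
  overlap (induced_chart a) (induced_chart b) u -> differentiable (jchange a b) u.
Proof.
move=> aa bb; rewrite overlap_inducedE // => -[ou1 ou2].
have [dt ddt] := (regular_line R).2 _ _ _ aa.1 bb.1 ou1.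
have [dx _] := (regular_manifold M).2 _ _ _ aa.2 bb.2 ou2.
have ox' : overlap b.2 a.2 (transition a.2 b.2 (xpart u)).
  case: ou2 => x [ax bx] <-; exists x => //.
  by rewrite (regular_transitionE (regular_manifold M) aa.2).
have [_ ddx] := (regular_manifold M).2 _ _ _ bb.2 aa.2 ox'.
have dtpart : differentiable (@tpart R n) u.
  by apply: linear_differentiable; exact: continuous_tpart.
have dxpart : differentiable (@xpart R n) u.
  by apply: linear_differentiable; exact: continuous_xpart.
apply/differentiable_mxP => i k; rewrite {i}ord1; elim/jindexP: k => [|i|i].
- have -> : (fun w => jchange a b w 0 it) =
      (fun t => transition a.1 b.1 t 0 0) \o @tpart R n.
    by apply/funext => w; exact: jchange_it.
  apply: differentiable_comp => //.
  exact: (differentiable_comp dt (differentiable_coord _ 0 0)).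
- have -> : (fun w => jchange a b w 0 (ix i)) =
      (fun t => transition a.2 b.2 t 0 i) \o @xpart R n.
    by apply/funext => w; exact: jchange_ix.
  apply: differentiable_comp => //.
  exact: (differentiable_comp dx (differentiable_coord _ 0 i)).
have -> : (fun w => jchange a b w 0 (ip i)) = \sum_(j < n)
    (((fun x => 'J (transition b.2 a.2) x i j) \o
        (transition a.2 b.2 \o @xpart R n)) *
     ((fun t => 'J (transition a.1 b.1) t 0 0) \o @tpart R n) *
     (fun w : 'rV[R]_(1 + n + n) => w 0 (ip j))).
  apply/funext => w; rewrite jchange_ip [LHS]mxE fct_sumE.
  by apply: eq_bigr => j _ /=; rewrite [ppart w 0 j]mxE.
apply: differentiable_sum => j.
apply: differentiableM; last exact: differentiable_coord.
apply: differentiableM; last by apply: differentiable_comp => //; exact: ddt.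
apply: differentiable_comp; last exact: ddx.
exact: differentiable_comp.
Qed.

Lemma p_change_linear a b t x : linear (p_change a b t x).
Proof.
move=> h q p; rewrite !p_changeE mulmxDl -scalemxAl scalerDr; congr (_ + _).
by rewrite !scalerA mulrC.
Qed.

Lemma derive_affine (V W : normedModType R) (f : V -> W) (u v : V) (c : W) :
  (forall h : R, f (h *: v + u) = h *: c + f u) -> 'D_v f u = c.
Proof.
move=> fE; transitivity ('D_c (@id W) (f u)); last exact: derive_id.
exact: derive_line.
Qed.

Definition dpdt a b u : 'rV[R]_n :=
  \row_j pderiv (fun w => jchange a b w 0 (ip j)) it u.

Definition dpdx a b u : 'M[R]_n :=
  \matrix_(i, j) pderiv (fun w => jchange a b w 0 (ip j)) (ix i) u.

(** Rows belong to the old coordinates: [A] and [B] are the base changes, [r] and [C] the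
    derivatives of the new fibre coordinates along t and x, and [D] the linear change on the
    fibre. *)
Definition jblock (A : 'M[R]_1) (B : 'M[R]_n) (r : 'rV[R]_n) (C D : 'M[R]_n) :
    'M[R]_(1 + n + n) :=
  block_mx (block_mx A 0 0 B) (col_mx r C) 0 D.

Lemma pderiv_tpart (f : 'rV[R]_1 -> R) k u :
  pderiv (fun w => f (tpart w)) k u = 'D_(tpart (delta_mx 0 k)) f (tpart u).
Proof. exact: (derive_comp_linear (@tpart R n)). Qed.

Lemma pderiv_xpart (f : 'rV[R]_n -> R) k u :
  pderiv (fun w => f (xpart w)) k u = 'D_(xpart (delta_mx 0 k)) f (xpart u).
Proof. exact: (derive_comp_linear (@xpart R n)). Qed.

Lemma jacobian_jchange a b u : jatlas a -> jatlas b ->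
  overlap (induced_chart a) (induced_chart b) u ->
  'J (jchange a b) u = jblock
    ('J (transition a.1 b.1) (tpart u)) ('J (transition a.2 b.2) (xpart u))
    (dpdt a b u) (dpdx a b u)
    ('J (transition a.1 b.1) (tpart u) 0 0 *:
       ('J (transition b.2 a.2) (transition a.2 b.2 (xpart u)))^T).
Proof.
move=> aa bb ou; have dj := differentiable_jchange aa bb ou.
move: ou; rewrite overlap_inducedE // => -[ou1 ou2].
have [dt _] := (regular_line R).2 _ _ _ aa.1 bb.1 ou1.
have [dx _] := (regular_manifold M).2 _ _ _ aa.2 bb.2 ou2.
have Jt k : 'J (jchange a b) u k it = 'D_(tpart (delta_mx 0 k))
    (fun t => transition a.1 b.1 t 0 0) (tpart u).
  transitivity (pderiv (fun w => jchange a b w 0 it) k u).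
    exact: jacobianE.
  rewrite -pderiv_tpart; congr (pderiv _ k u).
  by apply/funext => w; exact: jchange_it.
have Jx k i : 'J (jchange a b) u k (ix i) = 'D_(xpart (delta_mx 0 k))
    (fun x => transition a.2 b.2 x 0 i) (xpart u).
  transitivity (pderiv (fun w => jchange a b w 0 (ix i)) k u).
    exact: jacobianE.
  rewrite -pderiv_xpart; congr (pderiv _ k u).
  by apply/funext => w; exact: jchange_ix.
have Jp k i : 'J (jchange a b) u k (ip i) =
    pderiv (fun w => jchange a b w 0 (ip i)) k u by exact: jacobianE.
apply/matrixP => k l.
elim/jindexP: l => [|l|l]; elim/jindexP: k => [|k|k].
- rewrite [RHS]block_mxEul block_mxEul Jt tpart_delta_it.
  by apply: esym; exact: (jacobianE 0 0 dt).
- by rewrite Jt tpart_delta_ix derive0 [RHS]block_mxEul block_mxEdl mxE.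
- by rewrite Jt tpart_delta_ip derive0 [RHS]block_mxEdl mxE.
- by rewrite Jx xpart_delta_it derive0 [RHS]block_mxEul block_mxEur mxE.
- rewrite [RHS]block_mxEul block_mxEdr Jx xpart_delta_ix.
  by apply: esym; exact: (jacobianE k l dx).
- by rewrite Jx xpart_delta_ip derive0 [RHS]block_mxEdl mxE.
- by rewrite Jp [RHS]block_mxEur col_mxEu mxE.
- by rewrite Jp [RHS]block_mxEur col_mxEd mxE.
(* Along a fibre direction the base point is fixed and the new fibre coordinates are affine, so the
   derivative is their increment. *)
rewrite [RHS]block_mxEdr Jp; apply: derive_affine => h.
set q := h *: _.
have tq : tpart (q + u) = tpart u.
  by rewrite tpart_is_linear tpart_delta_ip scaler0 add0r.
have xq : xpart (q + u) = xpart u.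
  by rewrite xpart_is_linear xpart_delta_ip scaler0 add0r.
have pq : ppart (q + u) = h *: delta_mx 0 k + ppart u.
  apply/rowP => j; rewrite !mxE (inj_eq (@rshift_inj _ _)).
  by rewrite eqxx.
rewrite !jchange_ip tq xq pq p_change_linear mxE; congr (_ + _).
rewrite [LHS]mxE; congr (_ * _).
by rewrite p_changeE -rowE -linearZ; exact: mxE.
Qed.

End JetJacobian.

(** * Semisprays *)

Section TensorLaw.
Context {R : realType} {n : nat} {M : smooth_manifold R n}.
Implicit Types (a b : jlabel M) (u v : 'rV[R]_(1 + n + n)).

(** Every term of a semispray, temporal or spatial, has some dx^i as its covector, so only the
    x-rows of the coefficient matrix are nonzero. *)
Definition kblock (q : 'cV[R]_n) (S H : 'M[R]_n) : 'M[R]_(1 + n + n) :=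
  block_mx (block_mx 0 0 q S) (col_mx 0 H) 0 0.

Lemma kblock_inj q S H q' S' H' : kblock q S H = kblock q' S' H' -> H = H'.
Proof. by case/eq_block_mx => _ /eq_col_mx[]. Qed.

(** Only the x-rows of [kblock] are nonzero, and the x-columns of the left factor vanish outside its
    space block [B']. So the shape is preserved, and the derivatives [r'] and [C'] of the inverse
    change drop out. *)
Lemma jblock_kblock A B r C D A' B' r' C' D' q S H :
  jblock A' B' r' C' D' *m kblock q S H *m jblock A B r C D =
  kblock (B' *m (q *m A)) (B' *m S *m B) (B' *m (q *m r + S *m C + H *m D)).
Proof.
rewrite /jblock /kblock !mulmx_block ?mulmx0 ?mul0mx ?addr0 ?add0r.
rewrite !mulmx_block !mul_block_col !mul_col_mx ?mulmx0 ?mul0mx ?addr0 ?add0r.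
rewrite add_col_mx ?mulmx0 ?mul0mx ?addr0 ?add0r.
by rewrite !mulmxDr !mulmxA.
Qed.

Lemma jindexE : ((forall i : 'I_n, (it == ix i) = false) *
  (forall i : 'I_n, (ix i == it) = false) *
  (forall i : 'I_n, (it == ip i) = false) *
  (forall i : 'I_n, (ip i == it) = false) *
  (forall i j : 'I_n, (ix i == ip j) = false) *
  (forall i j : 'I_n, (ip i == ix j) = false) *
  (forall i j : 'I_n, (ix i == ix j) = (i == j)) *
  (forall i j : 'I_n, (ip i == ip j) = (i == j)))%type.
Proof.
do !split; move=> *; rewrite /it /ix /ip.
all: rewrite ?(inj_eq (@lshift_inj _ _)) ?(inj_eq (@rshift_inj _ _)).
all: by rewrite ?eq_lrshift ?eq_rlshift.
Qed.

Lemma kblockE q S H : ((kblock q S H it it = 0) *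
  (forall i, kblock q S H it (ix i) = 0) * (forall i, kblock q S H it (ip i) = 0) *
  (forall i, kblock q S H (ix i) it = q i 0) *
  (forall i j, kblock q S H (ix i) (ix j) = S i j) *
  (forall i j, kblock q S H (ix i) (ip j) = H i j) *
  (forall i k, kblock q S H (ip i) k = 0))%type.
Proof.
do !split; try move=> i j; try move=> i.
- by rewrite /kblock block_mxEul block_mxEul mxE.
- by rewrite /kblock block_mxEul block_mxEur mxE.
- by rewrite /kblock block_mxEur col_mxEu mxE.
- by rewrite /kblock block_mxEul block_mxEdl.
- by rewrite /kblock block_mxEul block_mxEdr.
- by rewrite /kblock block_mxEur col_mxEd.
- by elim/(@jindexP n): j => [|j|j]; rewrite /kblock ?block_mxEdl ?block_mxEdr mxE.
Qed.

Lemma kblock_linear c q S H q' S' H' :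
  c *: kblock q S H + kblock q' S' H' =
  kblock (c *: q + q') (c *: S + S') (c *: H + H').
Proof.
rewrite /kblock !scale_block_mx !scale_col_mx !scaler0.
by rewrite !add_block_mx add_col_mx !addr0.
Qed.

Lemma kblock0 : kblock 0 0 0 = 0.
Proof. by rewrite /kblock block_mx0 col_mx0 block_mx0. Qed.

Lemma kblock_sum I (r : seq I) (c : I -> R) (q : I -> 'cV[R]_n) (S H : I -> 'M[R]_n) :
  \sum_(i <- r) c i *: kblock (q i) (S i) (H i) = kblock
    (\sum_(i <- r) c i *: q i) (\sum_(i <- r) c i *: S i) (\sum_(i <- r) c i *: H i).
Proof.
elim: r => [|i r IHr]; first by rewrite !big_nil kblock0.
by rewrite !big_cons IHr kblock_linear.
Qed.

Lemma dtensor_xt i : @dtensor R n (ix i) it = kblock (delta_mx i 0) 0 0.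
Proof.
apply/matrixP => k l; rewrite mxE.
by elim/(@jindexP n): k => [|k|k]; elim/(@jindexP n): l => [|l|l];
  rewrite kblockE ?mxE !jindexE ?eqxx ?andbF ?andbT.
Qed.

Lemma dtensor_xx i j : @dtensor R n (ix i) (ix j) = kblock 0 (delta_mx i j) 0.
Proof.
apply/matrixP => k l; rewrite mxE.
by elim/(@jindexP n): k => [|k|k]; elim/(@jindexP n): l => [|l|l];
  rewrite kblockE ?mxE !jindexE ?eqxx ?andbF ?andbT.
Qed.

Lemma dtensor_xp i j : @dtensor R n (ix i) (ip j) = kblock 0 0 (delta_mx i j).
Proof.
apply/matrixP => k l; rewrite mxE.
by elim/(@jindexP n): k => [|k|k]; elim/(@jindexP n): l => [|l|l];
  rewrite kblockE ?mxE !jindexE ?eqxx ?andbF ?andbT.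
Qed.

(** The transpose reconciles two conventions: components of [G] carry the fibre index first,
    coefficient matrices of tensors the covector index. *)
Lemma sum_dtensor_xp (G : 'M[R]_n) :
  \sum_i \sum_j G j i *: @dtensor R n (ix i) (ip j) = kblock 0 0 G^T.
Proof.
transitivity (\sum_i 1 *: kblock 0 0 (\sum_j G^T i j *: delta_mx i j)).
  apply: eq_bigr => i _; rewrite scale1r.
  under eq_bigr do rewrite dtensor_xp.
  rewrite kblock_sum; congr kblock; try by apply: big1 => j _; rewrite scaler0.
  by apply: eq_bigr => j _; rewrite mxE.
rewrite kblock_sum; congr kblock; try by apply: big1 => j _; rewrite scaler0.
rewrite [RHS]matrix_sum_delta; apply: eq_bigr => i _; by rewrite scale1r.
Qed.

Lemma temporal_sum u (G : 'M[R]_n) :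
  \sum_i u 0 (ip i) *: @dtensor R n (ix i) it
    - 2 *: \sum_i \sum_j G j i *: @dtensor R n (ix i) (ip j) =
  kblock (ppart u)^T 0 (- (2 *: G^T)).
Proof.
rewrite sum_dtensor_xp -scaleNr; under eq_bigr do rewrite dtensor_xt.
rewrite kblock_sum addrC kblock_linear !scaler0 !add0r scaleNr; congr kblock.
- apply/colP => i; rewrite summxE (bigD1 i) //= big1 ?addr0 => [|j ji].
    by rewrite !mxE !eqxx mulr1.
  by rewrite !mxE eq_sym (negPf ji) mulr0.
- by rewrite big1 // => i _; rewrite scaler0.
- by rewrite big1 ?addr0 // => i _; rewrite scaler0.
Qed.

Lemma spatial_sum (G : 'M[R]_n) :
  \sum_i @dtensor R n (ix i) (ix i)
    - 2 *: \sum_i \sum_j G j i *: @dtensor R n (ix i) (ip j) =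
  kblock 0 1%:M (- (2 *: G^T)).
Proof.
rewrite sum_dtensor_xp -scaleNr.
under eq_bigr do rewrite dtensor_xx -[kblock _ _ _]scale1r.
rewrite kblock_sum addrC kblock_linear !scaler0 !add0r scaleNr; congr kblock.
- by rewrite big1 // => i _; rewrite scaler0.
- rewrite scalar_mx_sum_delta; apply: eq_bigr => i _; by rewrite scale1r.
- by rewrite big1 ?addr0 // => i _; rewrite scaler0.
Qed.

End TensorLaw.

(** * Transformation laws of semispray components *)

Section SemisprayLaw.
Context {R : realType} {n : nat} {M : smooth_manifold R n}.
Implicit Types (a b : jlabel M) (u v : 'rV[R]_(1 + n + n)).

Lemma overlap_sym a b u : jatlas a -> jatlas b ->
  overlap (induced_chart a) (induced_chart b) u ->
  overlap (induced_chart b) (induced_chart a) (jchange a b u).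
Proof.
move=> aa bb [z [az bz] <-]; exists z => //.
by apply: esym; exact: jchange_coord.
Qed.

Lemma jchangeK a b u : jatlas a -> jatlas b ->
  overlap (induced_chart a) (induced_chart b) u ->
  jchange b a (jchange a b u) = u.
Proof.
move=> aa bb [z [az bz] <-].
transitivity (jchange b a (coord (induced_chart b) z)).
  by congr (jchange b a _); exact: jchange_coord.
exact: jchange_coord.
Qed.

Lemma overlap_codom T m (c d : chart R T m) (u : 'rV[R]_m) : overlap c d u -> codom c u.
Proof. by move=> [x [cx _] <-]; exists x. Qed.

Lemma tpart_jchange a b u : tpart (jchange a b u) = transition a.1 b.1 (tpart u).
Proof. by rewrite /jchange tpart_row_mx. Qed.

Lemma xpart_jchange a b u : xpart (jchange a b u) = transition a.2 b.2 (xpart u).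
Proof. by rewrite /jchange xpart_row_mx. Qed.

Lemma ppart_jchange a b u :
  ppart (jchange a b u) = 'J (transition a.1 b.1) (tpart u) 0 0 *:
    (ppart u *m ('J (transition b.2 a.2) (xpart (jchange a b u)))^T).
Proof. by rewrite xpart_jchange -p_changeE /jchange ppart_row_mx. Qed.

Lemma jacobian_xK a b u : jatlas a -> jatlas b ->
  overlap (induced_chart a) (induced_chart b) u ->
  'J (transition b.2 a.2) (xpart (jchange a b u)) *m
    'J (transition a.2 b.2) (xpart u) = 1%:M.
Proof.
move=> aa bb; rewrite overlap_inducedE // => -[_ [x [ax bx] xu]].
rewrite xpart_jchange -xu (regular_transitionE (regular_manifold M) aa.2 ax bx).
exact: (jacobian_transition_inv (regular_manifold M) bb.2 aa.2).
Qed.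

Lemma jacobian_tK a b u : jatlas a -> jatlas b ->
  overlap (induced_chart a) (induced_chart b) u ->
  'J (transition b.1 a.1) (tpart (jchange a b u)) 0 0 *
    'J (transition a.1 b.1) (tpart u) 0 0 = 1.
Proof.
move=> aa bb; rewrite overlap_inducedE // => -[[t [at0 bt0] tu] _].
rewrite tpart_jchange -tu (time_transitionE aa.1 at0 bt0).
have := time_jacobian_refl bb.1 bt0.
have -> := time_jacobian_comp bb.1 aa.1 bb.1 bt0 at0 bt0.
by move=> /matrixP/(_ 0 0); rewrite mxE big_ord1 => ->; rewrite mxE eqxx.
Qed.

Lemma jacobian_induced a b u : jatlas a -> jatlas b ->
  overlap (induced_chart a) (induced_chart b) u ->
  'J (transition (induced_chart a) (induced_chart b)) u = 'J (jchange a b) u.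
Proof.
move=> aa bb ou; apply: esym; apply: near_eq_jacobian.
  apply: (open_near (open_overlap_induced aa bb) ou) => w ow.
  by apply: esym; exact: transition_inducedE.
exact: differentiable_jchange.
Qed.

(* The transformation law of a tensor q_i dx^i (x) d/dt + S_ij dx^i (x) d/dx^j
   + H_ij dx^i (x) d/dp_j, when its q and S parts already transform correctly. *)
Lemma kblock_law a b u (q q' : 'cV[R]_n) (S S' H H' : 'M[R]_n) :
  jatlas a -> jatlas b -> overlap (induced_chart a) (induced_chart b) u ->
  let v := transition (induced_chart a) (induced_chart b) u in
  let A := 'J (transition a.1 b.1) (tpart u) in
  let X := 'J (transition b.2 a.2) (xpart (jchange a b u)) in
  q' = X *m (q *m A) ->
  S' = X *m S *m 'J (transition a.2 b.2) (xpart u) ->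
  kblock q' S' H' = 'J (transition (induced_chart b) (induced_chart a)) v
    *m kblock q S H *m 'J (transition (induced_chart a) (induced_chart b)) u <->
  H' = X *m (q *m dpdt a b u + S *m dpdx a b u + H *m (A 0 0 *: X^T)).
Proof.
move=> aa bb ou /= qE SE.
have vE := transition_inducedE aa bb ou.
have ov := overlap_sym aa bb ou.
have Jb : 'J (transition (induced_chart b) (induced_chart a))
    (transition (induced_chart a) (induced_chart b) u) =
    'J (jchange b a) (jchange a b u).
  by rewrite vE; exact: jacobian_induced.
have E := etrans (congr2 (fun P Q => P *m kblock q S H *m Q)
  (etrans Jb (jacobian_jchange bb aa ov))
  (etrans (jacobian_induced aa bb ou) (jacobian_jchange aa bb ou)))
  (jblock_kblock _ _ _ _ _ _ _ _ _ _ _ _ _).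
split=> [qSH|->]; rewrite -xpart_jchange in E; first exact: kblock_inj (etrans qSH E).
by apply: etrans (esym E); rewrite qE SE.
Qed.

Lemma smooth_kblock m (A : set 'rV[R]_m) (q : 'rV[R]_m -> 'cV[R]_n)
    (S H : 'rV[R]_m -> 'M[R]_n) :
  smooth_mx A q -> smooth_mx A S -> smooth_mx A H ->
  smooth_mx A (fun w => kblock (q w) (S w) (H w)).
Proof.
move=> sq sS sH k l.
elim/(@jindexP n): k => [|k|k]; elim/(@jindexP n): l => [|l|l];
  under eq_fun do rewrite kblockE; by [exact: smooth_cst|exact: sq|exact: sS|exact: sH].
Qed.

Lemma smooth_const_mx m p r (A : set 'rV[R]_m) (B : 'M[R]_(p, r)) :
  smooth_mx A (fun=> B).
Proof. by move=> i j; exact: smooth_cst. Qed.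

Lemma smooth_opp_double_trmx a (G : 'rV[R]_(1 + n + n) -> 'M[R]_n) : jatlas a ->
  smooth_mx (codom (induced_chart a)) G ->
  smooth_mx (codom (induced_chart a)) (fun u => - (2 *: (G u)^T)).
Proof.
move=> aa sG i j; under eq_fun do rewrite !mxE -mulNr.
by apply: smoothM; [exact: open_codom_induced|exact: smooth_cst|exact: sG].
Qed.

Definition temporal_semispray_law
    (G : jlabel M -> 'rV[R]_(1 + n + n) -> 'M[R]_n) : Prop :=
  forall a b u, jatlas a -> jatlas b ->
    overlap (induced_chart a) (induced_chart b) u ->
    let v := jchange a b u in
    let X := 'J (transition b.2 a.2) (xpart v) in
    2 *: (G b v)^T = X *m (2 *: (G a u)^T *m
        ('J (transition a.1 b.1) (tpart u) 0 0 *: X^T) - (ppart u)^T *m dpdt a b u).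

(** The d/dt part has coefficients p_i, which transform correctly by the very law of the fibre
    coordinates ([qE]); the only condition left is on the d/dp part. *)
Lemma temporal_semisprayP (G : jlabel M -> 'rV[R]_(1 + n + n) -> 'M[R]_n) :
  temporal_semispray G <-> (local_functions G /\ temporal_semispray_law G).
Proof.
have qE a b u : (ppart (jchange a b u))^T =
    'J (transition b.2 a.2) (xpart (jchange a b u)) *m
    ((ppart u)^T *m 'J (transition a.1 b.1) (tpart u)).
  rewrite ppart_jchange.
  have scale_comm (A : 'M[R]_1) (X : 'M[R]_n) (p : 'rV[R]_n) :
      (A 0 0 *: (p *m X^T))^T = X *m (p^T *m A).
    by rewrite linearZ /= trmx_mul trmxK [A in RHS]mx11_scalar mul_mx_scalar linearZ.
  exact: scale_comm.
have SE a b u : 0 = 'J (transition b.2 a.2) (xpart (jchange a b u)) *m 0 *m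
    'J (transition a.2 b.2) (xpart u) by rewrite mulmx0 mul0mx.
have lawE (G1 G2 X C : 'M[R]_n) (Q D : 'M[R]_n) :
    - (2 *: G2^T) = X *m (Q + 0 *m C + - (2 *: G1^T) *m D) <->
    2 *: G2^T = X *m (2 *: G1^T *m D - Q).
  rewrite mul0mx addr0 mulNmx.
  have -> : Q - 2 *: G1^T *m D = - (2 *: G1^T *m D - Q) by rewrite opprB.
  by rewrite mulmxN; split=> [/oppr_inj|->].
split=> [[sG [K [[sK tK] KE]]]|[sG tG]]; split=> //.
  move=> a b u aa bb ou v X; apply/(lawE _ _ _ (dpdx a b u)).
  have := tK a b u aa bb ou; rewrite /=.
  rewrite (KE a u aa (overlap_codom ou)) temporal_sum.
  rewrite (KE b) //; last first.
    by rewrite transition_inducedE //; exact: overlap_codom (overlap_sym aa bb ou).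
  rewrite temporal_sum {1 2}transition_inducedE //.
  by move=> /(kblock_law _ _ aa bb ou (qE a b u) (SE a b u)).
exists (fun a u => kblock (ppart u)^T 0 (- (2 *: (G a u)^T))); split; last first.
  by move=> a u _ _; rewrite temporal_sum.
split=> [a aa|a b u aa bb ou v].
  apply: smooth_kblock; [|exact: smooth_const_mx|exact: smooth_opp_double_trmx (sG a aa)].
  by move=> i j; rewrite (ord1 j); under eq_fun do rewrite !mxE; exact: smooth_coord.
have vE : v = jchange a b u := transition_inducedE aa bb ou.
rewrite [in LHS]vE; apply/(kblock_law _ _ aa bb ou (qE a b u) (SE a b u)).
by apply/lawE; exact: tG.
Qed.

Definition spatial_semispray_law
    (G : jlabel M -> 'rV[R]_(1 + n + n) -> 'M[R]_n) : Prop :=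
  forall a b u, jatlas a -> jatlas b ->
    overlap (induced_chart a) (induced_chart b) u ->
    let v := jchange a b u in
    let X := 'J (transition b.2 a.2) (xpart v) in
    2 *: (G b v)^T = X *m (2 *: (G a u)^T *m
        ('J (transition a.1 b.1) (tpart u) 0 0 *: X^T) - dpdx a b u).

(** The d/dx part is the identity matrix, invariant because dx/dx~ and dx~/dx are inverse to each
    other ([SE]); again only the d/dp part carries a condition. *)
Lemma spatial_semisprayP (G : jlabel M -> 'rV[R]_(1 + n + n) -> 'M[R]_n) :
  spatial_semispray G <-> (local_functions G /\ spatial_semispray_law G).
Proof.
have qE a b u : 0 = 'J (transition b.2 a.2) (xpart (jchange a b u)) *m
    ((0 : 'cV[R]_n) *m 'J (transition a.1 b.1) (tpart u)).
  by rewrite mul0mx mulmx0.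
have SE a b u : jatlas a -> jatlas b ->
    overlap (induced_chart a) (induced_chart b) u ->
    1%:M = 'J (transition b.2 a.2) (xpart (jchange a b u)) *m 1%:M *m
    'J (transition a.2 b.2) (xpart u).
  by move=> aa bb ou; rewrite mulmx1 jacobian_xK.
have lawE (G1 G2 X C : 'M[R]_n) (r : 'rV[R]_n) (D : 'M[R]_n) :
    - (2 *: G2^T) = X *m (0 *m r + 1%:M *m C + - (2 *: G1^T) *m D) <->
    2 *: G2^T = X *m (2 *: G1^T *m D - C).
  rewrite mul0mx add0r mul1mx mulNmx.
  have -> : C - 2 *: G1^T *m D = - (2 *: G1^T *m D - C) by rewrite opprB.
  by rewrite mulmxN; split=> [/oppr_inj|->].
split=> [[sG [K [[sK tK] KE]]]|[sG tG]]; split=> //.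
  move=> a b u aa bb ou v X; apply/(lawE _ _ _ _ (dpdt a b u)).
  have := tK a b u aa bb ou; rewrite /=.
  rewrite (KE a u aa (overlap_codom ou)) spatial_sum.
  rewrite (KE b) //; last first.
    by rewrite transition_inducedE //; exact: overlap_codom (overlap_sym aa bb ou).
  rewrite spatial_sum {1}transition_inducedE //.
  by move=> /(@kblock_law a b u 0 0 1%:M 1%:M _ _ aa bb ou (qE a b u) (SE a b u aa bb ou)).
exists (fun a u => kblock 0 1%:M (- (2 *: (G a u)^T))); split; last first.
  by move=> a u _ _; rewrite spatial_sum.
split=> [a aa|a b u aa bb ou v].
  apply: smooth_kblock; [exact: smooth_const_mx|exact: smooth_const_mx|].
  exact: smooth_opp_double_trmx (sG a aa).
have vE : v = jchange a b u := transition_inducedE aa bb ou.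
rewrite [in LHS]vE; apply/(@kblock_law a b u 0 0 1%:M 1%:M _ _ aa bb ou (qE a b u) (SE a b u aa bb ou)).
by apply/lawE; exact: tG.
Qed.

End SemisprayLaw.

(** * Nonlinear connections *)

Section Connections.
Context {R : realType} {n : nat} {M : smooth_manifold R n}.
Implicit Types (a b : jlabel M) (u v : 'rV[R]_(1 + n + n)).

Lemma temporal_connectionP (N : jlabel M -> 'rV[R]_(1 + n + n) -> 'rV[R]_n) :
  temporal_nonlinear_connection N <-> (local_functions N /\
  forall a b u, jatlas a -> jatlas b ->
    overlap (induced_chart a) (induced_chart b) u ->
    let v := jchange a b u in
    N b v = N a u *m ('J (transition b.2 a.2) (xpart v))^T
      - 'J (transition b.1 a.1) (tpart v) 0 0 *: dpdt a b u).
Proof.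
have entry (N1 d : 'rV[R]_n) (X : 'M[R]_n) (c : R) (d' : 'I_n -> R) j :
    d 0 j = d' j -> (N1 *m X^T - c *: d) 0 j = \sum_k N1 0 k * X j k - c * d' j.
  by move=> dE; rewrite !mxE dE; congr (_ - _); apply: eq_bigr => k _; rewrite mxE.
split=> -[sN tN]; split=> //.
  move=> a b u aa bb ou v; apply/rowP => j.
  apply: etrans (tN a b u aa bb ou j) _; apply: esym.
  apply: (entry _ _ _ _ (fun j => pderiv (fun w => jchange a b w 0 (ip j)) it u)); exact: mxE.
move=> a b u aa bb ou v j; rewrite (tN a b u aa bb ou).
apply: (entry _ _ _ _ (fun j => pderiv (fun w => jchange a b w 0 (ip j)) it u)); exact: mxE.
Qed.

Lemma spatial_connectionP (N : jlabel M -> 'rV[R]_(1 + n + n) -> 'M[R]_n) :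
  spatial_nonlinear_connection N <-> (local_functions N /\
  forall a b u, jatlas a -> jatlas b ->
    overlap (induced_chart a) (induced_chart b) u ->
    let v := jchange a b u in
    let X := 'J (transition b.2 a.2) (xpart v) in
    N b v = 'J (transition a.1 b.1) (tpart u) 0 0 *: (X *m N a u *m X^T)
      - (X *m dpdx a b u)^T).
Proof.
have entry (N1 d X : 'M[R]_n) (c : R) (d' : 'I_n -> 'I_n -> R) j r :
    (forall i, d i j = d' i j) -> (c *: (X *m N1 *m X^T) - (X *m d)^T) j r =
    \sum_k \sum_i N1 k i * c * X j k * X r i - \sum_i X r i * d' i j.
  move=> dE; rewrite !mxE big_distrr exchange_big /=; congr (_ - _); last first.
    by apply: eq_bigr => i _; rewrite dE.
  apply: eq_bigr => i _; rewrite !mxE big_distrl big_distrr /=.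
  by apply: eq_bigr => k _; ring.
split=> -[sN tN]; split=> //.
  move=> a b u aa bb ou v X; apply/matrixP => j r.
  apply: etrans (tN a b u aa bb ou j r) _; apply: esym.
  apply: (entry _ _ _ _
    (fun i j => pderiv (fun w => jchange a b w 0 (ip j)) (ix i) u)) => i.
  exact: mxE.
move=> a b u aa bb ou v j r; rewrite (tN a b u aa bb ou).
apply: (entry _ _ _ _ (fun i j => pderiv (fun w => jchange a b w 0 (ip j)) (ix i) u)) => i.
exact: mxE.
Qed.

(** Transposition passes from the tensor layout to the component layout and the factor 2 is absorbed
    into [G], so both spatial claims are the two directions of one equivalence. *)
Lemma spatial_law_transpose (G1 G2 X D : 'M[R]_n) (c : R) :
  2 *: G2^T = X *m (2 *: G1^T *m (c *: X^T) - D) <->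
  2 *: G2 = c *: (X *m (2 *: G1) *m X^T) - (X *m D)^T.
Proof.
have -> : c *: (X *m (2 *: G1) *m X^T) - (X *m D)^T =
    (X *m (2 *: G1^T *m (c *: X^T) - D))^T.
  rewrite mulmxBr linearB /=; congr (_ - _).
  rewrite -scalemxAr -scalemxAl -scalemxAr -scalemxAl -!scalemxAr.
  rewrite !linearZ /= scalerA [RHS]scalerA.
  by rewrite mulrC !trmx_mul !trmxK.
have <- : (2 *: G2)^T = 2 *: G2^T by rewrite linearZ.
by split=> [<-|->]; rewrite trmxK.
Qed.

Lemma spatial_semispray_connection (G : jlabel M -> 'rV[R]_(1 + n + n) -> 'M[R]_n) :
  spatial_semispray G ->
  spatial_nonlinear_connection (fun a u => \matrix_(j, i) (2 * G a u j i)).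
Proof.
have -> : (fun (a : jlabel M) u => \matrix_(j, i) (2 * G a u j i)) =
    (fun a u => 2 *: G a u).
  by apply/funext => a; apply/funext => u; apply/matrixP => j i; rewrite !mxE.
move=> /spatial_semisprayP[sG tG]; apply/spatial_connectionP; split.
  move=> a aa i j; under eq_fun do rewrite mxE.
  apply: smoothM; [exact: open_codom_induced|exact: smooth_cst|exact: sG].
by move=> a b u aa bb ou v X; apply/spatial_law_transpose; exact: tG.
Qed.

Lemma spatial_connection_semispray (N : jlabel M -> 'rV[R]_(1 + n + n) -> 'M[R]_n) :
  spatial_nonlinear_connection N ->
  spatial_semispray (fun a u => \matrix_(j, i) (2^-1 * N a u j i)).
Proof.
have -> : (fun (a : jlabel M) u => \matrix_(j, i) (2^-1 * N a u j i)) =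
    (fun a u => 2^-1 *: N a u).
  by apply/funext => a; apply/funext => u; apply/matrixP => j i; rewrite !mxE.
move=> /spatial_connectionP[sN tN]; apply/spatial_semisprayP; split.
  move=> a aa i j; under eq_fun do rewrite mxE.
  apply: smoothM; [exact: open_codom_induced|exact: smooth_cst|exact: sN].
move=> a b u aa bb ou v X; apply/spatial_law_transpose.
rewrite !scalerA divff ?pnatr_eq0 // !scale1r; exact: tN.
Qed.

Lemma temporal_connection_semispray (N : jlabel M -> 'rV[R]_(1 + n + n) -> 'rV[R]_n) :
  temporal_nonlinear_connection N ->
  temporal_semispray (fun (a : jlabel M) u =>
    \matrix_(i, j) (2^-1 * N a u 0 i * u 0 (ip j))).
Proof.
move=> /temporal_connectionP[sN tN]; apply/temporal_semisprayP; split.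
  move=> a aa i j; under eq_fun do rewrite mxE.
  have oa := open_codom_induced aa.
  apply: smoothM => //; last exact: smooth_coord.
  apply: smoothM => //; [exact: smooth_cst|exact: sN].
move=> a b u aa bb ou v X.
(* For this choice of [G], twice its transpose is the outer product of p with the connection. *)
have GE (N1 : 'rV[R]_n) (w : 'rV[R]_(1 + n + n)) :
      2 *: (\matrix_(i, j) (2^-1 * N1 0 i * w 0 (ip j)))^T =
    (ppart w)^T *m N1.
  apply/matrixP => i j; rewrite !mxE big_ord1 !mxE.
  by rewrite mulrA mulVKf ?pnatr_eq0 // mulrC.
rewrite !GE (tN a b u aa bb ou).
have pv := ppart_jchange a b u.
have cc := jacobian_tK aa bb ou.
(* The factor dt~/dt carried by p~ cancels the dt/dt~ in the law of the connection, leaving exactly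
   p^T (dp~/dt). *)
have alg (p p' N1 d : 'rV[R]_n) (Y : 'M[R]_n) (c c' : R) :
    p' = c *: (p *m Y^T) -> c' * c = 1 ->
    p'^T *m (N1 *m Y^T - c' *: d) = Y *m (p^T *m N1 *m (c *: Y^T) - p^T *m d).
  move=> -> cc'; rewrite linearZ /= trmx_mul trmxK -!scalemxAl !mulmxBr.
  by rewrite -!scalemxAr scalerBr scalerA mulrC cc' scale1r !mulmxA.
exact: alg pv cc.
Qed.

End Connections.

(** * Contraction with the metric *)

Section Contraction.
Context {R : comUnitRingType} {n : nat}.
Implicit Types (P D X Y phi : 'M[R]_n) (p : 'rV[R]_n).

Lemma contractE P D : \sum_j \sum_k P j k * D j k = \tr (P^T *m D).
Proof.
rewrite exchange_big; apply: eq_bigr => k _; rewrite mxE.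
by apply: eq_bigr => j _; rewrite mxE.
Qed.

Lemma invmx_congruence X Y phi : X *m Y = 1%:M -> phi \in unitmx ->
  invmx (X *m phi *m X^T) = Y^T *m invmx phi *m Y.
Proof.
move=> XY phiU; have YX := mulmx1C XY.
have phi'U : X *m phi *m X^T \in unitmx.
  by rewrite !unitmx_mul unitmx_tr (mulmx1_unit XY).1 phiU.
rewrite -[RHS](mulmxK phi'U) -[LHS]mul1mx; congr (_ *m _).
rewrite !mulmxA -(mulmxA _ Y X) YX mulmx1 -(mulmxA _ (invmx phi) phi) mulVmx //.
by rewrite mulmx1 -trmx_mul XY trmx1.
Qed.

(** Contracting an upper with a lower 2-tensor is invariant: the two congruences use inverse
    matrices, which cancel under the cyclic trace. *)
Lemma contract_congruence P D X Y : X *m Y = 1%:M ->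
  \tr ((Y^T *m P *m Y)^T *m (X *m D *m X^T)) = \tr (P^T *m D).
Proof.
move=> XY; have YX := mulmx1C XY.
rewrite !trmx_mul trmxK -!mulmxA (mulmxA Y X) YX mul1mx.
by rewrite mxtrace_mulC -!mulmxA -trmx_mul YX trmx1 mulmx1.
Qed.

Lemma mxtrace_outer P p q : \tr (P *m (p^T *m q)) = (q *m P *m p^T) 0 0.
Proof. by rewrite mulmxA mxtrace_mulC mulmxA trace_mx11. Qed.

(* Contraction with the inverse metric turns the correction term of the fibre
   derivatives D into a multiple of p, because phi'^-1 contracted with
   delta_ir p_j + delta_ij p_r and then lowered by phi' is 2 p. *)
Lemma contraction_law (X Y phi phi' : 'M[R]_n) (D D' : 'I_n -> 'M[R]_n)
    (p' : 'rV[R]_n) (s : R) (N N' : 'rV[R]_n) :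
  X *m Y = 1%:M -> phi \in unitmx -> phi'^T = phi' -> phi' = X *m phi *m X^T ->
  (forall i, D' i = \sum_m Y m i *: (X *m D m *m X^T)
     - s *: (p'^T *m delta_mx 0 i + (delta_mx 0 i)^T *m p')) ->
  (forall r, N 0 r =
     \sum_j \sum_k \sum_i invmx phi j k * D i j k * phi i r) ->
  (forall r, N' 0 r =
     \sum_j \sum_k \sum_i invmx phi' j k * D' i j k * phi' i r) ->
  N' = N *m X^T - (s *+ 2) *: p'.
Proof.
move=> XY phiU phi'S phi'E DE NE N'E; have YX := mulmx1C XY.
have contracted (psi : 'M[R]_n) (E : 'I_n -> 'M[R]_n) (V : 'rV[R]_n) :
    (forall r, V 0 r = \sum_j \sum_k \sum_i invmx psi j k * E i j k * psi i r) ->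
    V = (\row_i \tr ((invmx psi)^T *m E i)) *m psi.
  move=> VE; apply/rowP => r; rewrite VE mxE.
  transitivity (\sum_i \sum_j \sum_k invmx psi j k * E i j k * psi i r).
    under eq_bigr do rewrite exchange_big; exact: exchange_big.
  apply: eq_bigr => i _; rewrite mxE -contractE big_distrl /=.
  by apply: eq_bigr => j _; rewrite big_distrl.
rewrite (contracted _ _ _ NE) (contracted _ _ _ N'E).
set g := \row_i \tr ((invmx phi)^T *m D i).
have phi'U : phi' \in unitmx.
  by rewrite phi'E !unitmx_mul unitmx_tr (mulmx1_unit XY).1 phiU.
have PS : (invmx phi')^T = invmx phi' by rewrite trmx_inv phi'S.
have -> : \row_i \tr ((invmx phi')^T *m D' i) =
    g *m Y - (s *+ 2) *: (p' *m invmx phi').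
  apply/rowP => i; rewrite !mxE DE mulmxBr mulmx_sumr !linearB /= linear_sum /=.
  congr (_ - _).
    apply: eq_bigr => m _; rewrite -scalemxAr linearZ /= mxE mulrC; congr (_ * _).
    by rewrite phi'E (invmx_congruence XY phiU) contract_congruence.
  rewrite -scalemxAr linearZ /= mulmxDr mxtraceD !mxtrace_outer PS.
  (* Symmetry of the inverse metric makes both outer products contribute the same number, whence the
     factor 2 on [s]. *)
  have -> : (delta_mx 0 i : 'rV[R]_n) *m invmx phi' *m p'^T = (p' *m invmx phi' *m (delta_mx 0 i)^T)^T.
    by rewrite !trmx_mul trmxK PS mulmxA.
  rewrite trmx_delta -colE [X in X + _]mxE -mulr2n mulrnAl mulrnAr.
  by rewrite !mxE.
rewrite mulmxBl -scalemxAl -(mulmxA p') mulVmx // mulmx1; congr (_ - _).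
by rewrite phi'E -!mulmxA (mulmxA Y X) YX mul1mx.
Qed.

End Contraction.

(** * Derivatives along the fibres *)

Section FibreDerivative.
Context {R : realType} {n : nat} {M : smooth_manifold R n}.
Implicit Types (a b : jlabel M) (u v : 'rV[R]_(1 + n + n)).

Definition time_second_derivative a b (t : 'rV[R]_1) : R :=
  pderiv (fun t' => 'J (transition a.1 b.1) t' 0 0) 0 t.

(** Moving along the t-axis keeps x and p fixed, and t enters the formula for p~ only through the
    scalar dt~/dt. *)
Lemma dpdtE a b u : jatlas a -> jatlas b ->
  overlap (induced_chart a) (induced_chart b) u ->
  dpdt a b u = time_second_derivative a b (tpart u) *:
    (ppart u *m ('J (transition b.2 a.2) (xpart (jchange a b u)))^T).
Proof.
move=> aa bb; rewrite overlap_inducedE // => -[ou1 _].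
have [_ ddt] := (regular_line R).2 _ _ _ aa.1 bb.1 ou1.
rewrite xpart_jchange.
set V := ppart u *m _.
apply/rowP => j.
have JE h : jchange a b (h *: delta_mx 0 it + u) 0 (ip j) =
    V 0 j * 'J (transition a.1 b.1) (h *: delta_mx 0 0 + tpart u) 0 0.
  have tq : tpart (h *: delta_mx 0 it + u) = h *: delta_mx 0 0 + tpart u.
    by rewrite tpart_is_linear tpart_delta_it.
  have xq : xpart (h *: delta_mx 0 it + u) = xpart u.
    by rewrite xpart_is_linear xpart_delta_it scaler0 add0r.
  have pq : ppart (h *: delta_mx 0 it + u) = ppart u.
    by apply/rowP => k; rewrite !mxE -/it jindexE andbF mulr0 add0r.
  rewrite jchange_ip tq xq pq p_changeE mulrC; exact: mxE.
transitivity ('D_(delta_mx 0 0)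
    (V 0 j *: (fun t' => 'J (transition a.1 b.1) t' 0 0)) (tpart u)).
  apply: etrans (mxE _ _ _ _) _; exact: derive_line.
rewrite deriveZ; last by apply: diff_derivable; exact: ddt.
by rewrite [RHS]mxE; exact: mulrC.
Qed.

Lemma congruence_entry (B X : 'M[R]_n) c j r :
  (c *: (X *m B *m X^T)) j r = \sum_i \sum_l (c * (X j i * X r l)) * B i l.
Proof.
rewrite !mxE exchange_big big_distrr; apply: eq_bigr => l _ /=.
rewrite !mxE big_distrl big_distrr; apply: eq_bigr => i _ /=.
ring.
Qed.

Lemma outer_entry (x y : 'rV[R]_n) j r : (x^T *m y) j r = x 0 j * y 0 r.
Proof. by rewrite mxE big_ord1 mxE. Qed.

(* Along a fibre of the bundle the jet coordinates change affinely and the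
   Jacobian factors are constant. *)
Lemma derive_fibre (f : 'rV[R]_(1 + n + n) -> R)
    (G : 'rV[R]_(1 + n + n) -> 'M[R]_n) (X : 'M[R]_n) (c k : R) u v
    (dv du : 'rV[R]_(1 + n + n)) (q : 'rV[R]_n) j r :
  (forall i l, differentiable (fun w => G w i l) u) ->
  (forall h, ppart (h *: du + u) = h *: q + ppart u) ->
  (forall h, f (h *: dv + v) = (c *: (X *m G (h *: du + u) *m X^T)
     - k *: ((ppart (h *: du + u) *m X^T)^T *m (ppart (h *: du + u) *m X^T))) j r) ->
  'D_dv f v = (c *: (X *m (\matrix_(i, l) 'D_du (fun w => G w i l) u) *m X^T)
     - k *: ((ppart u *m X^T)^T *m (q *m X^T) + (q *m X^T)^T *m (ppart u *m X^T))) j r.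
Proof.
move=> dG pE fE.
pose L l := fun w => (ppart w *m X^T) 0 l.
have DL l : 'D_du (L l) u = (q *m X^T) 0 l.
  by apply: derive_affine => h; rewrite /L pE mulmxDl -scalemxAl !mxE.
have dL l : differentiable (L l) u.
  rewrite (_ : L l = \sum_i X l i *: (fun w : 'rV[R]_(1 + n + n) => w 0 (ip i))).
    apply: differentiable_sum => i; apply: differentiableZ.
    exact: differentiable_coord.
  apply/funext => w; rewrite fct_sumE /L mxE; apply: eq_bigr => i _.
  by rewrite !mxE mulrC.
pose F i l := (c * (X j i * X r l)) *: (fun w => G w i l).
have dF i l : derivable (F i l) u du.
  by apply: derivableZ; exact: diff_derivable.
have dLL : derivable (L j * L r) u du.
  by apply: derivableM; exact: diff_derivable.
have dsF i : derivable (\sum_l F i l) u du := derivable_sum (dF i).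
have subE (A B : 'M[R]_n) : (A - k *: B) j r = A j r - k * B j r by rewrite !mxE.
have addE (A B : 'M[R]_n) : (A + B) j r = A j r + B j r by rewrite !mxE.
transitivity ('D_du (\sum_i \sum_l F i l - k *: (L j * L r)) u).
  apply: derive_line => h; rewrite fE subE congruence_entry outer_entry.
  rewrite !fctE fct_sumE; congr (_ - _); apply: eq_bigr => i _.
  by rewrite fct_sumE.
rewrite deriveB; [|exact: derivable_sum|exact: derivableZ].
rewrite deriveZ // deriveM; [|exact: diff_derivable|exact: diff_derivable].
rewrite (derive_sum dsF) !DL subE congruence_entry addE !outer_entry; congr (_ - _ * _).
  apply: eq_bigr => i _; rewrite (derive_sum (dF i)); apply: eq_bigr => l _.
  rewrite /F (deriveZ _ (diff_derivable (dG i l))) [_ i l]mxE; exact: erefl.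
by congr (_ + _); exact: mulrC.
Qed.

Definition fibre_derivative (G : jlabel M -> 'rV[R]_(1 + n + n) -> 'M[R]_n) a u
    (m : 'I_n) : 'M[R]_n :=
  \matrix_(j, k) pderiv (fun w => G a w j k) (ip m) u.

Lemma derive_vertical (f : 'rV[R]_(1 + n + n) -> R) u (q : 'rV[R]_n) :
  differentiable f u ->
  'D_(row_mx 0 q) f u = \sum_m q 0 m * pderiv f (ip m) u.
Proof.
move=> df; rewrite derive_pderiv // big_split_ord /= big1 ?add0r => [|i _].
  by apply: eq_bigr => m _; rewrite row_mxEr.
by rewrite row_mxEl mxE mul0r.
Qed.

(** The line through v in the direction of p~_i is carried by [jchange b a] to a line through u in
    the fibre direction q, with components q_m = c' Y_mi. The factor c of the semispray law cancels
    this c', so the first sum has no time factor; in the second term the half comes from solving for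
    G~ and c'^2 from rewriting p X^T as c' p~. *)
Lemma fibre_derivative_law (G : jlabel M -> 'rV[R]_(1 + n + n) -> 'M[R]_n) a b u i :
  local_functions G -> temporal_semispray_law G ->
  jatlas a -> jatlas b -> overlap (induced_chart a) (induced_chart b) u ->
  let v := jchange a b u in
  let X := 'J (transition b.2 a.2) (xpart v) in
  let Y := 'J (transition a.2 b.2) (xpart u) in
  let c' := 'J (transition b.1 a.1) (tpart v) 0 0 in
  fibre_derivative G b v i =
    \sum_m Y m i *: (X *m fibre_derivative G a u m *m X^T)
    - (2^-1 * time_second_derivative a b (tpart u) * c' ^+ 2) *:
      ((ppart v)^T *m delta_mx 0 i + (delta_mx 0 i)^T *m ppart v).
Proof.
move=> sG tG aa bb ou v X Y c'.
have cc : c' * 'J (transition a.1 b.1) (tpart u) 0 0 = 1 := jacobian_tK aa bb ou.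
have XY : X *m Y = 1%:M := jacobian_xK aa bb ou.
have pv : ppart v = 'J (transition a.1 b.1) (tpart u) 0 0 *: (ppart u *m X^T).
  exact: ppart_jchange.
have ov : overlap (induced_chart b) (induced_chart a) v := overlap_sym aa bb ou.
have vK : jchange b a v = u := jchangeK aa bb ou.
pose q := p_change b a (tpart v) (xpart v) (delta_mx 0 i).
have qE : q = c' *: (delta_mx 0 i *m Y^T).
  have xE : transition b.2 a.2 (xpart v) = xpart u.
    exact: etrans (esym (xpart_jchange b a v)) (congr1 (@xpart R n) vK).
  apply: etrans (p_changeE _ _ _ _ _) _.
  exact: (congr1 (fun x : 'rV[R]_n => c' *: ((delta_mx 0 i : 'rV[R]_n) *m
    ('J (transition a.2 b.2) x)^T)) xE).
set c := 'J (transition a.1 b.1) (tpart u) 0 0 in cc pv.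
set k := time_second_derivative a b (tpart u).
pose dv : 'rV[R]_(1 + n + n) := delta_mx 0 (ip i).
have td h : tpart (h *: dv + v) = tpart v.
  by rewrite tpart_is_linear tpart_delta_ip scaler0 add0r.
have xd h : xpart (h *: dv + v) = xpart v.
  by rewrite xpart_is_linear xpart_delta_ip scaler0 add0r.
have pd h : ppart (h *: dv + v) = h *: delta_mx 0 i + ppart v.
  by apply/rowP => l; rewrite !mxE -/(ip l) jindexE.
have shift h : jchange b a (h *: dv + v) = h *: row_mx 0 q + u.
  rewrite -vK /jchange td xd pd p_change_linear -/q scale_row_mx add_row_mx.
  by rewrite scaler0 add0r.
(* The whole line stays in the overlap because overlaps do not restrict p; hence the semispray law
   is available for every [h]. *)
have oh h : overlap (induced_chart b) (induced_chart a) (h *: dv + v).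
  by move: ov; rewrite overlap_inducedE //= td xd.
have dG j l : differentiable (fun w => G a w j l) u.
  exact: smooth_differentiable (sG a aa j l) (overlap_codom ou).
(* The semispray law solved for G~: once d is a multiple of p B^T, the correction is a quadratic
   form in p B^T. *)
have halve (G1 G2 B : 'M[R]_n) (p d : 'rV[R]_n) (x y : R) :
    2 *: G2^T = B *m (2 *: G1^T *m (x *: B^T) - p^T *m d) -> d = y *: (p *m B^T) ->
    G2 = x *: (B *m G1 *m B^T) - (2^-1 * y) *: ((p *m B^T)^T *m (p *m B^T)).
  move=> /(congr1 (fun A => 2^-1 *: A^T)) G2E dE.
  have -> : G2 = 2^-1 *: (2 *: G2^T)^T.
    by rewrite linearZ /= trmxK scalerA mulVf ?pnatr_eq0 // scale1r.
  rewrite G2E dE mulmxBr -!scalemxAr -!scalemxAl -!scalemxAr linearB /= !linearZ /=.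
  rewrite !scalerA !trmx_mul !trmxK !mulmxA scalerDr !scalerA; congr (_ *: _ + _).
  by rewrite mulrCA mulVf ?pnatr_eq0 // mulr1.
have fE j r h : G b (h *: dv + v) j r =
    (c *: (X *m G a (h *: row_mx 0 q + u) *m X^T) - (2^-1 * k) *:
      ((ppart (h *: row_mx 0 q + u) *m X^T)^T *m
       (ppart (h *: row_mx 0 q + u) *m X^T))) j r.
  have wK := jchangeK bb aa (oh h).
  have ow := overlap_sym bb aa (oh h).
  have tw : tpart (h *: row_mx 0 q + u) = tpart u.
    by rewrite -shift tpart_jchange td -tpart_jchange vK.
  rewrite shift in wK ow.
  have lE := tG a b _ aa bb ow; cbv zeta in lE; rewrite wK xd tw in lE.
  have dE := dpdtE aa bb ow; rewrite wK xd tw in dE.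
  by have /matrixP/(_ j r) := halve _ _ _ _ _ _ _ lE dE.
have pE h : ppart (h *: row_mx 0 q + u) = h *: q + ppart u.
  apply/rowP => l; rewrite mxE [LHS]mxE [(h *: row_mx _ _) _ _]mxE row_mxEr.
  by rewrite !mxE.
apply/matrixP => j r; rewrite [LHS]mxE.
apply: etrans (derive_fibre dG pE (fE j r)) _.
congr (fun_of_matrix _ j r); congr (_ - _).
  have -> : \matrix_(i0, l) 'D_(row_mx 0 q) (fun w => G a w i0 l) u =
      \sum_m q 0 m *: fibre_derivative G a u m.
    apply/matrixP => s l; rewrite mxE derive_vertical // summxE.
    by apply: eq_bigr => m _; rewrite !mxE.
  rewrite mulmx_sumr mulmx_suml scaler_sumr; apply: eq_bigr => m _.
  rewrite -scalemxAr -scalemxAl scalerA qE; congr (_ *: _).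
  by rewrite mxE mulrA [c * _]mulrC cc mul1r -rowE !mxE.
have pX : ppart u *m X^T = c' *: ppart v by rewrite pv scalerA cc scale1r.
have qX : q *m X^T = c' *: delta_mx 0 i.
  by rewrite qE -scalemxAl -mulmxA -trmx_mul XY trmx1 mulmx1.
rewrite pX qX !linearZ /= -!scalemxAl !scalerA -scalerDr scalerA.
by congr (_ *: _); rewrite expr2 !mulrA.
Qed.

End FibreDerivative.

(** * From temporal semisprays to connections, and the theorem *)

Lemma temporal_semispray_connection (R : realType) (n : nat)
    (M : smooth_manifold R n) (phi : chart R M n -> 'rV[R]_n -> 'M[R]_n)
    (hphi : semi_riemannian_metric phi)
    (G : jlabel M -> 'rV[R]_(1 + n + n) -> 'M[R]_n) :
  temporal_semispray G ->
  temporal_nonlinear_connection (fun (a : jlabel M) u =>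
    \row_r \sum_j \sum_k \sum_i
      invmx (phi a.2 (xpart u)) j k
      * pderiv (fun w => G a w j k) (ip i) u
      * phi a.2 (xpart u) i r).
Proof.
move=> /temporal_semisprayP[sG tG]; apply/temporal_connectionP.
have [[sphi tphi] [phiP _]] := hphi.
split=> [a aa i r|a b u aa bb ou v].
  under eq_fun do rewrite mxE.
  have oa := open_codom_induced aa.
  have oc : open (codom a.2).
    by rewrite codom_overlap; apply: open_overlap; exact: atlas_chart aa.2.
  have smooth_x (f : 'rV[R]_n -> R) : smooth (codom a.2) f ->
      smooth (codom (induced_chart a)) (fun u => f (xpart u)).
    move=> sf; apply: (@smooth_comp_linear _ _ _ _ _ (@xpart R n)) sf => //.
    - exact: continuous_xpart.
    - by move=> u; rewrite codom_inducedE // => -[].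
  apply: smooth_sum => // j _; apply: smooth_sum => // k _.
  apply: smooth_sum => // l _; apply: smoothM => //; last first.
    exact: (smooth_x (fun x => phi a.2 x l r)) (sphi a.2 aa.2 l r).
  apply: smoothM => //; last exact: smooth_pderiv (sG a aa j k).
  apply: (smooth_x (fun x => invmx (phi a.2 x) j k)).
  apply: smooth_invmx => //; last exact: sphi aa.2.
  by move=> x cx; have [] := phiP a.2 x aa.2 cx.
have ox := ou; rewrite overlap_inducedE // in ox; case: ox => _ ox.
have ov := overlap_sym aa bb ou.
have ovx := ov; rewrite overlap_inducedE // in ovx; case: ovx => _ ovx.
have [_ phiU] := phiP a.2 _ aa.2 (overlap_codom ox).
have [phi'S _] := phiP b.2 _ bb.2 (overlap_codom ovx).
have phi'E : phi b.2 (xpart v) = 'J (transition b.2 a.2) (xpart v)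
    *m phi a.2 (xpart u) *m ('J (transition b.2 a.2) (xpart v))^T.
  by have := tphi _ _ _ aa.2 bb.2 ox; cbv zeta; rewrite -xpart_jchange.
have fibreE (c : jlabel M) (w : 'rV[R]_(1 + n + n)) r :
    (\row_r \sum_j \sum_k \sum_i invmx (phi c.2 (xpart w)) j k
      * pderiv (fun w => G c w j k) (ip i) w * phi c.2 (xpart w) i r) 0 r =
    \sum_j \sum_k \sum_i invmx (phi c.2 (xpart w)) j k
      * fibre_derivative G c w i j k * phi c.2 (xpart w) i r.
  rewrite mxE; do 3![apply: eq_bigr => ? _]; congr (_ * _ * _).
  by apply: esym; exact: mxE.
apply: etrans (contraction_law (jacobian_xK aa bb ou) phiU phi'S phi'E
  (fun i => fibre_derivative_law i sG tG aa bb ou) (fibreE a u) (fibreE b v)) _.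
congr (_ - _).
have pv := ppart_jchange a b u; have cc := jacobian_tK aa bb ou.
apply: etrans _ (esym (congr1 (fun d => _ *: d) (dpdtE aa bb ou))).
(* The contraction yields twice the coefficient k c'^2 / 2, applied to p~ = c (p X^T); one c'
   cancels c, and the rest is c' (dp~/dt). *)
have alg (c c' k : R) (p' p : 'rV[R]_n) : p' = c *: p -> c' * c = 1 ->
    (2^-1 * k * c' ^+ 2 *+ 2) *: p' = c' *: (k *: p).
  move=> -> cc'; rewrite !scalerA; congr (_ *: _).
  have -> : 2^-1 * k * c' ^+ 2 *+ 2 * c = k * c' * (c' * c) * (2^-1 * 2) by ring.
  by rewrite cc' mulVf ?pnatr_eq0 // !mulr1 mulrC.
exact: alg pv cc.
Qed.

Theorem proposition17 (R : realType) (n : nat) (M : smooth_manifold R n)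
    (phi : chart R M n -> 'rV[R]_n -> 'M[R]_n)
    (hphi : semi_riemannian_metric phi) :
  ((forall G : jlabel M -> 'rV[R]_(1 + n + n) -> 'M[R]_n,
      temporal_semispray G ->
      temporal_nonlinear_connection (fun (a : jlabel M) u =>
        \row_r \sum_j \sum_k \sum_i
          invmx (phi a.2 (xpart u)) j k
          * pderiv (fun w => G a w j k) (ip i) u
          * phi a.2 (xpart u) i r)) /\
   (forall N : jlabel M -> 'rV[R]_(1 + n + n) -> 'rV[R]_n,
      temporal_nonlinear_connection N ->
      temporal_semispray (fun (a : jlabel M) u =>
        \matrix_(i, j) (2^-1 * N a u 0 i * u 0 (ip j))))) /\
  ((forall G : jlabel M -> 'rV[R]_(1 + n + n) -> 'M[R]_n,
      spatial_semispray G ->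
      spatial_nonlinear_connection (fun (a : jlabel M) u =>
        \matrix_(j, i) (2 * G a u j i))) /\
   (forall N : jlabel M -> 'rV[R]_(1 + n + n) -> 'M[R]_n,
      spatial_nonlinear_connection N ->
      spatial_semispray (fun (a : jlabel M) u =>
        \matrix_(j, i) (2^-1 * N a u j i)))).
Proof.
split; split.
- exact: temporal_semispray_connection.
- exact: temporal_connection_semispray.
- exact: spatial_semispray_connection.
- exact: spatial_connection_semispray.
Qed.
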